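(* Let $d>1$, let $V_{\rm per}\colon\mathbb R^d\to\mathbb R$ be a continuous $1$-periodic function, and let $W\colon\mathbb R^d\to[0,+\infty)$ be a bounded and uniformly continuous function for which there is a dense subset $\Xi$ of $\mathbb R^d\setminus\{0\}$ such that $$\lim_{R\to+\infty}\frac1R\int_{B_R\cap S^r_\xi}W(x)\,dx=0\qquad\text{for all }\xi\in\Xi\text{ and all }r>0.$$ Let $H(x,\xi)=\frac14|\xi|^2-V_{\rm per}(x)-W(x)$ and let $H_{\rm hom}=f_{\rm hom}^*$ be the Fenchel conjugate of $$f_{\rm hom}(\xi)=\lim_{T\to+\infty}\frac1T\min\Big\{\int_0^T\big(|v'(t)+\xi|^2+V_{\rm per}(v(t)+t\xi)\big)dt: v\in H^1_0((0,T);\mathbb R^d)\Big\}.$$ Fix $\lambda>0$. For every $\varepsilon>0$ let $U_\varepsilon\in W^{1,\infty}(\mathbb R^d)$ be the unique viscosity solution of $$\lambda U_\varepsilon(x)+H\Big(\frac x\varepsilon,\nabla U_\varepsilon(x)\Big)=0\quad\text{in }\mathbb R^d,$$ and let $U\in W^{1,\infty}(\mathbb R^d)$ be the unique viscosity solution of $$\lambda U(x)+H_{\rm hom}(\nabla U(x))=0\quad\text{in }\mathbb R^d.$$ Then $U_\varepsilon$ tends to $U$ uniformly on compact sets of $\mathbb R^d$ as $\varepsilon\to0$.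
   Context: $B_R$ is the open ball in $\mathbb R^d$ with centre $0$ and radius $R$. For $\xi\in\mathbb R^d\setminus\{0\}$ and $r>0$, $S^r_\xi:=\{t\xi+z:t\in\mathbb R,\ z\in\mathbb R^d,\ |z|<r\}$ is the circular cylinder with axis in direction $\xi$ and radius $r$. $1$-periodic means invariant under translations by vectors of $\mathbb Z^d$. The Fenchel conjugate is $f^*(\xi)=\sup_{\eta\in\mathbb R^d}\big(\xi\cdot\eta-f(\eta)\big)$. The existence of the limit defining $f_{\rm hom}$, and the existence and uniqueness in $W^{1,\infty}(\mathbb R^d)$ of the viscosity solutions $U_\varepsilon$ and $U$, are known facts. *)

(* Defs.v *)
From HB Require Import structures.
From mathcomp Require Import all_boot all_order all_algebra.
From mathcomp Require Import all_classical all_reals all_analysis.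

Set Implicit Arguments.
Unset Strict Implicit.
Unset Printing Implicit Defensive.

Import Order.TTheory GRing.Theory Num.Theory.
Import numFieldNormedType.Exports.

Local Open Scope classical_set_scope.
Local Open Scope ring_scope.

(* The topology, uniformity and differential calculus on 'rV[R]_d are the
   library's.  They come from the sup norm `|x|, which is equivalent to the
   Euclidean norm; wherever the value of |x| matters, enorm is used. *)
Definition dot (R : realType) (d : nat) (x y : 'rV[R]_d) : R :=
  \sum_(i < d) x 0 i * y 0 i.

Definition enorm (R : realType) (d : nat) (x : 'rV[R]_d) : R :=
  Num.sqrt (dot x x).

Definition eball (R : realType) (d : nat) (r : R) : set 'rV[R]_d :=
  [set x | enorm x < r].

Definition cylinder (R : realType) (d : nat) (r : R) (xi : 'rV[R]_d) :
    set 'rV[R]_d :=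
  [set x | exists t : R, exists z : 'rV[R]_d, enorm z < r /\ x = t *: xi + z].

Definition periodic1 (R : realType) (d : nat) (V : 'rV[R]_d -> R) : Prop :=
  forall (k : 'rV[int]_d) (x : 'rV[R]_d), V (x + map_mx intr k) = V x.

Section measurable_rV.
Variables (R : realType) (n : nat).

Let coors (i : 'I_n) (x : 'rV[R]_n) : measurableTypeR R := x 0 i.

Let rV_set0 : g_sigma_preimage coors set0.
Proof. exact: sigma_algebra0. Qed.

Let rV_setC A : g_sigma_preimage coors A -> g_sigma_preimage coors (~` A).
Proof. exact: sigma_algebraC. Qed.

Let rV_bigcup (F : (set 'rV[R]_n)^nat) :
  (forall i, g_sigma_preimage coors (F i)) ->
  g_sigma_preimage coors (\bigcup_i (F i)).
Proof. exact: sigma_algebra_bigcup. Qed.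

(* The product sigma-algebra, that is, the Borel sigma-algebra. *)
HB.instance Definition _ := @isMeasurable.Build default_measure_display
  'rV[R]_n (g_sigma_preimage coors) rV_set0 rV_setC rV_bigcup.

Lemma measurable_coord (i : 'I_n) :
  measurable_fun [set: 'rV[R]_n] (fun x => x 0 i : measurableTypeR R).
Proof.
move=> _ Y mY; rewrite setTI; apply: sub_sigma_algebra => /=.
rewrite -bigcup_seq/=; exists i => /=; first by rewrite mem_index_enum.
by exists Y => //; rewrite setTI.
Qed.

Lemma measurable_fun_rV d (T : measurableType d) (f : T -> 'rV[R]_n) :
  (forall i, measurable_fun [set: T] (fun x => f x 0 i : measurableTypeR R)) ->
  measurable_fun [set: T] f.
Proof.
move=> mf _ A mA; rewrite setTI.
suff : g_sigma_preimage coors `<=` [set B | measurable (f @^-1` B)] by exact.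
apply: smallest_sub.
  split=> /=.
  - by rewrite preimage_set0.
  - by move=> B mB; rewrite setTD -preimage_setC; exact: measurableC.
  - by move=> F mF; rewrite preimage_bigcup; exact: bigcup_measurable.
move=> B; rewrite -bigcup_seq => -[i _ [C mC <-]] /=.
by rewrite setTI -[X in measurable X]setTI; exact: (mf i).
Qed.

End measurable_rV.

Section lebesgue_rV.
Variable R : realType.

Definition cons_rV (n : nat) (p : measurableTypeR R * 'rV[R]_n) :
    'rV[R]_n.+1 :=
  row_mx (p.1)%:M p.2.

Definition uncons_rV (n : nat) (x : 'rV[R]_n.+1) :
    measurableTypeR R * 'rV[R]_n :=
  (x 0 ord0, \row_i x 0 (lift ord0 i)).

Lemma cons_rV0 n (p : measurableTypeR R * 'rV[R]_n) : cons_rV p 0 ord0 = p.1.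
Proof.
have -> : ord0 = lshift n 0 :> 'I_(1 + n) by exact: val_inj.
by rewrite /cons_rV (@row_mxEl _ 1 1 n) mxE eqxx mulr1n.
Qed.

Lemma cons_rVS n (p : measurableTypeR R * 'rV[R]_n) i :
  cons_rV p 0 (lift ord0 i) = p.2 0 i.
Proof.
have -> : lift ord0 i = rshift 1 i :> 'I_(1 + n) by exact: val_inj.
by rewrite /cons_rV (@row_mxEr _ 1 1 n).
Qed.

Lemma cons_rVK n : cancel (@cons_rV n) (@uncons_rV n).
Proof.
case=> a v; rewrite /uncons_rV cons_rV0; congr pair.
by apply/rowP => i; rewrite mxE cons_rVS.
Qed.

Lemma measurable_cons_rV n : measurable_fun setT (@cons_rV n).
Proof.
apply: measurable_fun_rV => i; case: (unliftP ord0 i) => [j ->|->].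
- under eq_fun do rewrite cons_rVS.
  exact: (measurableT_comp (measurable_coord j) measurable_snd).
- by under eq_fun do rewrite cons_rV0; exact: measurable_fst.
Qed.

Lemma measurable_uncons_rV n : measurable_fun setT (@uncons_rV n).
Proof.
apply/measurable_fun_pairP; split; first exact: measurable_coord.
apply: measurable_fun_rV => i /=.
by under eq_fun do rewrite mxE; exact: measurable_coord.
Qed.

Section step.
Variables (n : nat) (mu : {sigma_finite_measure set 'rV[R]_n -> \bar R}).

(* The product of one-dimensional Lebesgue measure and mu, transported to
   'rV[R]_n.+1. *)
Definition lebesgue_rV_step : set 'rV[R]_n.+1 -> \bar R :=
  pushforward (@lebesgue_measure R \x mu)%E (@cons_rV n).

HB.instance Definition _ := Measure.copy lebesgue_rV_step
  (measure_function_pushforward__canonical__measure_function_Measure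
    (@lebesgue_measure R \x mu)%E (@measurable_cons_rV n)).

Let step_sigma_finite : sigma_finite setT lebesgue_rV_step.
Proof.
have /sigma_finiteP[F [FT ndF Foo]] := sigma_finiteT (@lebesgue_measure R).
have /sigma_finiteP[G [GT ndG Goo]] := sigma_finiteT mu.
exists (fun k => @uncons_rV n @^-1` (F k `*` G k)).
  apply/seteqP; split => // x _.
  have [i _ Fi] : (\bigcup_k F k) (uncons_rV x).1 by rewrite -FT.
  have [j _ Gj] : (\bigcup_k G k) (uncons_rV x).2 by rewrite -GT.
  exists (maxn i j) => //; split.
  - by move: Fi; exact/subsetPset/ndF/leq_maxl.
  - by move: Gj; exact/subsetPset/ndG/leq_maxr.
move=> k; have [mF Fk] := Foo k; have [mG Gk] := Goo k; split.
  rewrite -[X in measurable X]setTI; apply: measurable_uncons_rV => //.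
  exact: measurableX.
rewrite /lebesgue_rV_step /pushforward -comp_preimage.
rewrite (_ : _ \o _ = id); last by apply/funext => p; exact: cons_rVK.
by rewrite preimage_id product_measure1E// lte_mul_pinfty// ge0_fin_numE.
Qed.

HB.instance Definition _ := Measure_isSigmaFinite.Build _ _ _ lebesgue_rV_step
  step_sigma_finite.

End step.

Fixpoint lebesgue_rV (n : nat) :
    {sigma_finite_measure set 'rV[R]_n -> \bar R} :=
  match n with
  | 0 => \d_(0 : 'rV[R]_0)
  | m.+1 => lebesgue_rV_step (lebesgue_rV m)
  end.

Lemma lebesgue_rV_box n (A : 'I_n -> set (measurableTypeR R)) :
  (forall i, measurable (A i)) ->
  lebesgue_rV n [set x | forall i, A i (x 0 i)] =
  (\prod_(i < n) @lebesgue_measure R (A i))%E.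
Proof.
elim: n A => [|n IHn] A mA.
  by rewrite big_ord0 /= diracE mem_set//; case.
rewrite big_ord_recl -IHn //.
set B := [set x : 'rV[R]_n | forall i, A (lift ord0 i) (x 0 i)].
have mB : measurable B.
  rewrite (_ : B = \bigcap_(i in [set: 'I_n])
    ((fun x : 'rV[R]_n => x 0 i : measurableTypeR R) @^-1` A (lift ord0 i))).
    apply: fin_bigcap_measurable => // i _.
    by rewrite -[X in measurable X]setTI; exact: measurable_coord.
  by apply/seteqP; split => x Bx i; [move=> _|]; exact: Bx.
rewrite -product_measure1E//.
rewrite -[LHS]/((@lebesgue_measure R \x lebesgue_rV n)%E (_ @^-1` _)).
congr (_ _).
apply/seteqP; split => [p Ap|p [p1 p2] i] /=.
- split => [|i]; first by rewrite -(cons_rV0 p).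
  by rewrite -cons_rVS.
- by case: (unliftP ord0 i) => [j ->|->]; rewrite ?cons_rVS ?cons_rV0.
Qed.

End lebesgue_rV.

Definition grad (R : realType) (d : nat) (f : 'rV[R]_d -> R) (x : 'rV[R]_d) :
    'rV[R]_d :=
  \row_(i < d) 'D_(delta_mx 0 i) f x.

Fixpoint class_C (R : realType) (d : nat) (k : nat) (f : 'rV[R]_d -> R) : Prop :=
  match k with
  | 0 => continuous f
  | j.+1 => (forall x, differentiable f x) /\
            (forall i, class_C j (fun x => grad f x 0 i))
  end.

Definition test_fun (R : realType) (d : nat) (phi : 'rV[R]_d -> R) : Prop :=
  (forall k, class_C k phi) /\ compact (closure [set x | phi x != 0]).

Definition weak_partial (R : realType) (d : nat) (i : 'I_d)
    (u g : 'rV[R]_d -> R) : Prop :=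
  forall phi, test_fun phi ->
    \int[lebesgue_rV R d]_x (u x * grad phi x 0 i) =
    - \int[lebesgue_rV R d]_x (g x * phi x).

Definition W1oo (R : realType) (d : nat) (u : 'rV[R]_d -> R) : Prop :=
  u \in Lfun (lebesgue_rV R d) +oo%E /\
  (forall i, exists2 g : 'rV[R]_d -> R,
     g \in Lfun (lebesgue_rV R d) +oo%E & weak_partial i u g).

(* Viscosity solutions of F (x, u, Du) = 0 on the whole space, with the sign
   convention for which F is nondecreasing in its second argument. *)
Definition viscosity_subsolution (R : realType) (d : nat)
    (F : 'rV[R]_d -> R -> 'rV[R]_d -> R) (u : 'rV[R]_d -> R) : Prop :=
  forall phi, class_C 1 phi -> forall x0,
    (\forall x \near x0, u x - phi x <= u x0 - phi x0) ->
    F x0 (u x0) (grad phi x0) <= 0.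

Definition viscosity_supersolution (R : realType) (d : nat)
    (F : 'rV[R]_d -> R -> 'rV[R]_d -> R) (u : 'rV[R]_d -> R) : Prop :=
  forall phi, class_C 1 phi -> forall x0,
    (\forall x \near x0, u x0 - phi x0 <= u x - phi x) ->
    0 <= F x0 (u x0) (grad phi x0).

Definition viscosity_solution (R : realType) (d : nat)
    (F : 'rV[R]_d -> R -> 'rV[R]_d -> R) (u : 'rV[R]_d -> R) : Prop :=
  [/\ continuous u, viscosity_subsolution F u & viscosity_supersolution F u].

Definition test_fun_itv (R : realType) (T : R) (phi : R -> R) : Prop :=
  (forall k t, derivable (derive1n k phi) t 1) /\
  closure [set t | phi t != 0] `<=` `]0, T[.

Definition L2_itv (R : realType) (T : R) (f : R -> R) : Prop :=
  measurable_fun `]0, T[ f /\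
  (\int[@lebesgue_measure R]_(t in `]0%R, T[) (f t ^+ 2)%:E < +oo)%E.

Definition weak_deriv_itv (R : realType) (T : R) (f g : R -> R) : Prop :=
  forall phi, test_fun_itv T phi ->
    \int[@lebesgue_measure R]_(t in `]0, T[) (f t * derive1 phi t) =
    - \int[@lebesgue_measure R]_(t in `]0, T[) (g t * phi t).

(* f is in H^1_0(0,T) with weak derivative g: f is in H^1(0,T) and is a limit,
   in the H^1 norm, of smooth functions with compact support in ]0,T[. *)
Definition H10_itv (R : realType) (T : R) (f g : R -> R) : Prop :=
  [/\ L2_itv T f, L2_itv T g, weak_deriv_itv T f g &
    exists phi : nat -> R -> R,
      [/\ forall k, test_fun_itv T (phi k),
          (\int[@lebesgue_measure R]_(t in `]0%R, T[)
            ((phi k t - f t) ^+ 2)%:E)%E @[k --> \oo] --> 0%E &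
          (\int[@lebesgue_measure R]_(t in `]0%R, T[)
            ((derive1 (phi k) t - g t) ^+ 2)%:E)%E @[k --> \oo] --> 0%E]].

Definition H10_itv_rV (R : realType) (d : nat) (T : R) (v v' : R -> 'rV[R]_d) :
    Prop :=
  forall i, H10_itv T (fun t => v t 0 i) (fun t => v' t 0 i).

Definition cell_energies (R : realType) (d : nat) (V : 'rV[R]_d -> R) (T : R)
    (xi : 'rV[R]_d) : set R :=
  [set e | exists v v' : R -> 'rV[R]_d, H10_itv_rV T v v' /\
     e = \int[@lebesgue_measure R]_(t in `]0, T[)
           (enorm (v' t + xi) ^+ 2 + V (v t + t *: xi))].

(* The minimum in the cell problem is attained for T > 0, so it is the
   infimum of the energies. *)
Definition is_fhom (R : realType) (d : nat) (V f : 'rV[R]_d -> R) : Prop :=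
  forall xi, T^-1 * inf (cell_energies V T xi) @[T --> +oo] --> f xi.

(* The real-valued sup: the supremum is finite when f is bounded below by
   a quadratic, as is the case of f_hom. *)
Definition fenchel (R : realType) (d : nat) (f : 'rV[R]_d -> R)
    (xi : 'rV[R]_d) : R :=
  sup [set dot xi eta - f eta | eta in [set: 'rV[R]_d]].

(* Main.v *)
Require Import Defs.
From HB Require Import structures.
From mathcomp Require Import all_boot all_order all_algebra.
From mathcomp Require Import all_classical all_reals all_analysis.
From mathcomp Require Import measurable_realfun ess_sup_inf ring lra.

(** The limit problem is degenerate in a way that makes the theorem elementary:
    its solution is a constant.  Write [m] for the minimum of [Vper].  The
    Hamiltonian of the limit equation does not depend on the position, so its
    bounded solution is the constant [- fenchel fhom 0 / lambda], which is
    [inf fhom / lambda], and this infimum is [m].  Indeed a curve with fixed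
    end points has mean velocity [xi], so [|xi|^2 + m <= fhom xi]
    ([cell_energy_ge], [fhom_ge]), and with [xi = 0] it can spend most of its
    time at a minimum point of [Vper] ([cell_energy_cutoff_le], [fhom0_le]).
    The smooth transitions needed there are built from [exp (- 1 / t)].

    It remains to see that [lambda * Ueps eps] tends to [m], locally uniformly.
    The lower bound [m <= lambda * Ueps eps] follows from [Vper + W >= m]
    ([supersolution_ge]).  For the upper bound, the equation makes the
    functions [Ueps eps] Lipschitz uniformly in [eps], and, its quadratic term
    being nonnegative, bounds [lambda * Ueps eps y] by the potential
    [Vper + W] at [y / eps]; both facts are combined in
    [subsolution_le_potential].  So it is enough to find, close to every given
    point, a point [y] such that [y / eps] is the translate by a lattice vector
    of a minimum point of [Vper] and [W (y / eps)] is small.  Near a direction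
    [xi] of the dense set such points exist, since otherwise [W] would be
    bounded below on about [1 / eps] disjoint balls of fixed size in a cylinder
    around the axis [xi], and its integral would not be small compared with
    [1 / eps] ([quiet_lattice_point]).

    All viscosity inequalities are tested with one family of functions, the
    smoothed cones [k * sqrt (e^2 + |z - y|^2)]: they are of class C^1, grow at
    infinity, so that a bounded continuous function is touched, and have
    gradients of norm less than [|k|]. *)

Set Implicit Arguments.
Unset Strict Implicit.
Unset Printing Implicit Defensive.

Import Order.TTheory GRing.Theory Num.Theory.
Import numFieldNormedType.Exports.

Local Open Scope classical_set_scope.
Local Open Scope ring_scope.

(** * Euclidean norm and sup norm *)

Section euclidean.
Context {R : realType} {d : nat}.
Implicit Types x y z : 'rV[R]_d.

Lemma dot_ge0 x : 0 <= dot x x.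
Proof. by apply: sumr_ge0 => i _; rewrite -expr2 sqr_ge0. Qed.

Lemma sqr_enorm x : enorm x ^+ 2 = dot x x.
Proof. by rewrite sqr_sqrtr// dot_ge0. Qed.

Lemma dotZZ (a : R) x : dot (a *: x) (a *: x) = a ^+ 2 * dot x x.
Proof. by rewrite /dot mulr_sumr; apply: eq_bigr => i _; rewrite !mxE; ring. Qed.

Lemma le_normr_dot x : `|x| ^+ 2 <= dot x x.
Proof.
rewrite -[`|x|]/(mx_norm x).
have [->|x0] := eqVneq (mx_norm x) 0; first by rewrite expr0n dot_ge0.
have [[i j] ->] := mx_norm_neq0 x0; rewrite ord1 /=.
rewrite /dot (bigD1 j)//= real_normK ?num_real// expr2 lerDl.
by apply: sumr_ge0 => k _; rewrite -expr2 sqr_ge0.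
Qed.

Lemma le_coord_norm x i : `|x 0 i| <= `|x|.
Proof.
rewrite [leRHS]mx_normrE; apply: (le_bigmax _ (fun p => `|x p.1 p.2|) (0, i)).
Qed.

Lemma dot_le_normr x : dot x x <= d%:R ^+ 2 * `|x| ^+ 2.
Proof.
apply: (@le_trans _ _ (\sum_(i < d) `|x| ^+ 2)).
  apply: ler_sum => i _; rewrite -expr2 -real_normK ?num_real//.
  by rewrite lerXn2r ?nnegrE// le_coord_norm.
rewrite sumr_const card_ord -[leLHS]mulr_natl ler_wpM2r ?sqr_ge0//.
by rewrite -natrX ler_nat; case: (d) => // n; rewrite leq_pmulr.
Qed.

Lemma le_norm_enorm x : `|x| <= enorm x.
Proof.
by rewrite -(@ler_pXn2r _ 2) ?nnegrE ?sqrtr_ge0// ?sqr_enorm ?le_normr_dot.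
Qed.

Lemma enorm_le_norm x : enorm x <= d%:R * `|x|.
Proof.
by rewrite -(@ler_pXn2r _ 2) ?nnegrE ?sqrtr_ge0 ?mulr_ge0// sqr_enorm exprMn dot_le_normr.
Qed.

End euclidean.

(** * Smoothed cones as test functions *)

(** The Euclidean distance to [y] with its vertex rounded off at scale [e]. *)
Definition cone (R : realType) (d : nat) (e : R) (y z : 'rV[R]_d) : R :=
  Num.sqrt (e ^+ 2 + dot (z - y) (z - y)).

Section cone.
Context {R : realType} {d : nat}.
Variables (e : R) (y : 'rV[R]_d).
Hypothesis e0 : 0 < e.
Implicit Types z : 'rV[R]_d.

Let arg_gt0 z : 0 < e ^+ 2 + dot (z - y) (z - y).
Proof. by rewrite ltr_wpDr ?dot_ge0// exprn_gt0. Qed.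

Lemma cone_gt0 z : 0 < cone e y z.
Proof. by rewrite sqrtr_gt0. Qed.

Lemma sqr_cone z : cone e y z ^+ 2 = e ^+ 2 + dot (z - y) (z - y).
Proof. by rewrite sqr_sqrtr// ltW. Qed.

Lemma cone_center : cone e y y = e.
Proof.
by rewrite /cone subrr /dot big1 ?addr0 ?sqrtr_sqr ?gtr0_norm// => i _; rewrite !mxE mul0r.
Qed.

Lemma le_cone z : e <= cone e y z.
Proof.
by rewrite -(@ler_pXn2r _ 2) ?nnegrE ?(ltW e0) ?sqrtr_ge0// sqr_cone lerDl dot_ge0.
Qed.

Lemma le_norm_cone z : `|z - y| <= cone e y z.
Proof.
rewrite -(@ler_pXn2r _ 2) ?nnegrE ?(ltW e0) ?sqrtr_ge0// sqr_cone.
by rewrite (le_trans (le_normr_dot _))// lerDr sqr_ge0.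
Qed.

Lemma cone_le z : cone e y z <= d%:R * `|z - y| + e.
Proof.
rewrite -(@ler_pXn2r _ 2) ?nnegrE ?sqrtr_ge0 ?addr_ge0 ?mulr_ge0 ?(ltW e0)//.
rewrite sqr_cone; have := dot_le_normr (z - y).
have : 0 <= d%:R * `|z - y| by rewrite mulr_ge0.
by move: e0; set a := _%:R; set b := `|_|; set c := dot _ _ => ??; nra.
Qed.

Let coord_lin i (x : 'rV[R]_d) := x 0 i.

Let coord_linP i : linear (coord_lin i : 'rV[R]_d -> R).
Proof. by move=> a u v; rewrite /coord_lin !mxE. Qed.

HB.instance Definition _ i :=
  GRing.isLinear.Build R 'rV[R]_d R _ (coord_lin i) (coord_linP i).

Let is_derive_coord z v i : is_derive z v (coord_lin i) (v 0 i).
Proof.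
have dc : differentiable (coord_lin i) z by exact: differentiable_coord.
apply: DeriveDef; first exact: diff_derivable.
by rewrite deriveE// diff_lin//; exact: coord_continuous.
Qed.

Let arg z : R := e ^+ 2 + dot (z - y) (z - y).

Let argE : arg = cst (e ^+ 2) +
  \sum_(i < d) (coord_lin i - cst (y 0 i)) * (coord_lin i - cst (y 0 i)).
Proof.
apply/funext => z; rewrite /arg /dot fctE fct_sumE; congr (_ + _).
by apply: eq_bigr => i _; rewrite !mxE.
Qed.

Let differentiable_arg z : differentiable arg z.
Proof.
rewrite argE; apply: differentiableD => //; apply: differentiable_sum => i.
by apply: differentiableM; apply: differentiableB => //; exact: differentiable_coord.
Qed.

Let derive_arg z v : 'D_v arg z = 2 * dot (z - y) v.
Proof.
rewrite argE deriveD ?derive_cst ?add0r//; last first.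
  by apply: derivable_sum => i; apply: derivableM; apply: derivableB => //;
     exact: diff_derivable (differentiable_coord _ _ _).
rewrite derive_sum => [|i]; last first.
  by apply: derivableM; apply: derivableB => //;
     exact: diff_derivable (differentiable_coord _ _ _).
rewrite /dot mulr_sumr; apply: eq_bigr => i _.
have := is_derive_coord z v i => iv.
rewrite derive_val !mxE /= /coord_lin /cst subr0 !fctE /GRing.scale/=; ring.
Qed.

Lemma differentiable_cone z : differentiable (cone e y) z.
Proof.
apply: (@differentiable_comp _ _ _ _ arg Num.sqrt) => //.
apply/derivable1_diffP.
by have /@ex_derive := is_derive1_sqrt (arg_gt0 z).
Qed.

Lemma grad_cone z : grad (cone e y) z = (cone e y z)^-1 *: (z - y).
Proof.
apply/rowP => i; rewrite !mxE deriveE; last exact: differentiable_cone.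
have ds : differentiable Num.sqrt (arg z).
  apply/derivable1_diffP.
  by have /@ex_derive := is_derive1_sqrt (arg_gt0 z).
rewrite (@diff_comp _ _ _ _ arg Num.sqrt)//= diff1E// -deriveE// derive_arg.
rewrite derive1E derive_sqrt; last exact: arg_gt0.
rewrite -/(cone e y z) /dot (bigD1 i)//= big1 => [|j /negbTE ji].
  rewrite !mxE /= eqxx addr0 /GRing.scale/= invfM; field.
  by rewrite gt_eqF// cone_gt0.
by rewrite !mxE /= ji mulr0.
Qed.

Lemma continuous_cone : continuous (cone e y).
Proof. by move=> z; apply: differentiable_continuous; exact: differentiable_cone. Qed.

Lemma gradZ (k : R) (f : 'rV[R]_d -> R) z : differentiable f z ->
  grad (k \*: f) z = k *: grad f z.
Proof.
by move=> df; apply/rowP => i; rewrite !mxE deriveZ//; exact: diff_derivable.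
Qed.

Lemma class_C1_cone (k : R) : class_C 1 (k \*: cone e y).
Proof.
split=> [z|i]; first by apply: differentiableZ; exact: differentiable_cone.
have -> : (fun z => grad (k \*: cone e y) z 0 i) =
    (fun z => k * ((cone e y z)^-1 * (z 0 i - y 0 i))).
  apply/funext => z; rewrite gradZ; last exact: differentiable_cone.
  by rewrite grad_cone !mxE.
move=> z.
have h1 : (cone e y x)^-1 @[x --> z] --> (cone e y z)^-1.
  have c0 : cone e y z != 0 by rewrite gt_eqF// cone_gt0.
  by apply: (@cvgV _ _ (nbhs z) _ _ _ c0); exact: continuous_cone.
have h2 : x 0 i - y 0 i @[x --> z] --> z 0 i - y 0 i.
  by apply: (@cvgB _ _ _ (nbhs z)); [exact: coord_continuous|exact: cvg_cst].
exact: (@cvgM _ _ (nbhs z) _ _ _ _ _ (cvg_cst k) (cvgM h1 h2)).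
Qed.

(** The gradient is shorter than [k] by an amount that reveals the distance to
    the vertex. *)
Lemma enorm_grad_cone (k : R) z :
  enorm ((k / cone e y z) *: (z - y)) ^+ 2 =
  k ^+ 2 * (1 - e ^+ 2 / cone e y z ^+ 2).
Proof.
rewrite sqr_enorm dotZZ; have := sqr_cone z.
have := cone_gt0 z; set c := cone e y z => c0 cE.
have -> : dot (z - y) (z - y) = c ^+ 2 - e ^+ 2 by rewrite cE; ring.
by field; rewrite gt_eqF.
Qed.

End cone.

Section touching.
Context {R : realType} {d : nat}.
Implicit Types (u : 'rV[R]_d -> R) (y z : 'rV[R]_d).

Lemma cone_max_attained u (M k e : R) y : continuous u ->
  (forall x, `|u x| <= M) -> 0 < k -> 0 < e ->
  exists z0, forall z, u z - k * cone e y z <= u z0 - k * cone e y z0.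
Proof.
move=> cu uM k0 e0.
pose f z := u z - k * cone e y z.
have cf : continuous f.
  move=> z; apply: (@cvgB _ _ _ (nbhs z)); first exact: cu.
  by apply: (@cvgM _ _ (nbhs z)); [exact: cvg_cst|exact: continuous_cone].
pose r := (M + M) / k + e.
have M0 : 0 <= M by exact: le_trans (uM y).
have r0 : 0 <= r by rewrite addr_ge0 ?(ltW e0)// divr_ge0 ?addr_ge0// ltW.
have cA : compact [set z : 'rV[R]_d | `|z - y| <= r].
  apply: bounded_closed_compact.
    exists (`|y| + r); split; first exact: num_real.
    move=> s /ltW yrs z /= zr; apply: le_trans yrs.
    by rewrite -[z](subrK y) (le_trans (ler_normD _ _))// addrC lerD2l.
  rewrite (_ : mkset _ = (fun z => `|z - y|) @^-1` [set s | s <= r])//.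
  apply: closed_comp; last exact: closed_le.
  move=> z _; apply: (@cvg_norm _ _ _ (nbhs z)).
  by apply: (@cvgB _ _ _ (nbhs z)); [exact: cvg_id|exact: cvg_cst].
have A0 : [set z : 'rV[R]_d | `|z - y| <= r] !=set0.
  by exists y => /=; rewrite subrr normr0.
have [z0 _ z0P] := EVT_max_rV A0 cA (continuous_subspaceT cf).
exists z0 => z; have [zr|zr] := leP `|z - y| r.
  by apply: z0P; rewrite inE.
have yA : y \in [set z : 'rV[R]_d | `|z - y| <= r].
  by rewrite inE /= subrr normr0.
have := z0P _ yA; rewrite /f cone_center//.
have /ler_normlP[_ uz] := uM z; have /ler_normlP[uy _] := uM y.
have krE : k * r = M + M + k * e by rewrite /r; field; rewrite gt_eqF.
have : k * r <= k * cone e y z.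
  by rewrite ler_pM2l// (le_trans (ltW zr))// le_norm_cone.
by move: uz uy krE; lra.
Qed.

(** The gradient at the point of contact is kept explicit, because both its
    size and its defect from [k] are used. *)
Lemma subsolution_cone (F : 'rV[R]_d -> R -> 'rV[R]_d -> R) u (M k e : R) y :
  viscosity_subsolution F u -> continuous u -> (forall x, `|u x| <= M) ->
  0 < k -> 0 < e ->
  exists2 z0, (forall z, u z - k * cone e y z <= u z0 - k * cone e y z0) &
    F z0 (u z0) ((k / cone e y z0) *: (z0 - y)) <= 0.
Proof.
move=> Fu cu uM k0 e0; have [z0 z0P] := cone_max_attained y cu uM k0 e0.
exists z0 => //.
have := Fu _ (class_C1_cone y e0 k) z0.
rewrite gradZ; last exact: differentiable_cone.
by rewrite grad_cone// scalerA; apply; apply: (@filterE _ (nbhs z0)) => z; exact: z0P.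
Qed.

Lemma supersolution_cone (F : 'rV[R]_d -> R -> 'rV[R]_d -> R) u (M k e : R) y :
  viscosity_supersolution F u -> continuous u -> (forall x, `|u x| <= M) ->
  0 < k -> 0 < e ->
  exists2 z0, (forall z, u z0 + k * cone e y z0 <= u z + k * cone e y z) &
    0 <= F z0 (u z0) ((- k / cone e y z0) *: (z0 - y)).
Proof.
move=> Fu cu uM k0 e0.
have cNu : continuous (fun x => - u x).
  by move=> z; apply: (@cvgN _ _ _ (nbhs z)); exact: cu.
have NuM x : `|- u x| <= M by rewrite normrN.
have [z0 z0P] := cone_max_attained y cNu NuM k0 e0.
have z0P' z : u z0 + k * cone e y z0 <= u z + k * cone e y z.
  by have := z0P z; lra.
exists z0 => //.
have := Fu _ (class_C1_cone y e0 (- k)) z0.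
rewrite gradZ; last exact: differentiable_cone.
rewrite grad_cone// scalerA; apply; apply: (@filterE _ (nbhs z0)) => z /=.
by have := z0P' z; rewrite /GRing.scale/=; lra.
Qed.

End touching.

(** * A smooth step on the line *)

Section flat_exponential.
Context {R : realType}.
Implicit Types (p : {poly R}) (t : R).

(** The parameter [p] is there to make the class stable under
    differentiation. *)
Definition flat_exp p t : R :=
  if 0 < t then p.[t^-1] * expR (- t^-1) else 0.

Definition flat_exp_deriv p : {poly R} := 'X^2 * (p - p^`()).

(** Flatness at the origin to every order: each factor ['X] in [p] costs one
    power of [t], and [exp] beats all powers. *)
Lemma flat_exp_le p n : exists2 K, 0 <= K & forall t, 0 <= t ->
  `|flat_exp p t| <= K * t ^+ n.
Proof.
elim/poly_ind: p n => [|p c IHp] n.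
  by exists 0 => // t _; rewrite /flat_exp horner0 mul0r if_same normr0 mul0r.
have [K K0 pK] := IHp n.+1.
exists (K + `|c| * n`!%:R); first by rewrite addr_ge0// mulr_ge0.
move=> t t0; have := pK t t0; rewrite /flat_exp; case: ifPn => [{}t0 pt|_ _].
  have e0 := expR_gt0 (- t^-1).
  rewrite hornerMXaddC mulrDl mulrDl (le_trans (ler_normD _ _))// lerD//.
    rewrite mulrAC normrM [`|t^-1|]gtr0_norm ?invr_gt0// ler_pdivrMr//.
    by rewrite -mulrA -exprSr.
  rewrite normrM -mulrA ler_wpM2l// gtr0_norm//.
  have f0 : 0 < n`!%:R :> R by rewrite ltr0n fact_gt0.
  rewrite expRN -[leRHS]invrK lef_pV2 ?posrE ?expR_gt0 ?invr_gt0 ?mulr_gt0 ?exprn_gt0//.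
  rewrite invfM -exprVn mulrC; case: n {IHp pK pt f0} => [|n].
    by rewrite fact0 invr1 mulr1 expr0 ltW// expR_gt1 invr_gt0.
  by rewrite (le_trans _ (expR_ge1Dxn n _))// ?lerDr// ltW// invr_gt0.
by rewrite normr0 mulr_ge0 ?exprn_ge0 ?addr_ge0 ?mulr_ge0.
Qed.

Lemma is_derive_flat_exp p t :
  is_derive t 1 (flat_exp p) (flat_exp (flat_exp_deriv p) t).
Proof.
have [t0|t0|->] := ltgtP t 0.
- rewrite {2}/flat_exp ltNge (ltW t0)/=.
  apply: (near_eq_is_derive (f := cst 0)).
  near=> s; rewrite /flat_exp ltNge ltW//.
  by near: s; exact: lt_nbhsl.
- rewrite {2}/flat_exp t0.
  have D0 : is_derive t 1 (fun s => p.[s^-1] * expR (- s^-1))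
      ((flat_exp_deriv p).[t^-1] * expR (- t^-1)).
    have t0' : t != 0 by rewrite gt_eqF.
    pose y := t^-1.
    have dV : is_derive t 1 (fun s : R => s^-1) (- y ^+ 2).
      have := @is_deriveV R id t 1 1 t0' _; rewrite /GRing.scale/= mulr1.
      by rewrite exprVn; apply; exact: is_derive_id.
    have dN : is_derive t 1 (fun s : R => - s^-1) (y ^+ 2).
      by rewrite -[y ^+ 2]opprK; exact: is_deriveN.
    have dE : is_derive t 1 (fun s : R => expR (- s^-1)) (y ^+ 2 * expR (- y)).
      rewrite mulrC.
      by apply: (@is_derive1_comp _ expR (fun s => - s^-1)).
    have dP : is_derive t 1 (fun s : R => p.[s^-1]) (- y ^+ 2 * p^`().[y]).
      rewrite mulrC.
      by apply: (@is_derive1_comp _ (horner p) (fun s => s^-1)).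
    rewrite /flat_exp_deriv hornerM hornerXn hornerD hornerN -/y.
    have := is_deriveM dP dE; rewrite /GRing.scale/= => D.
    by apply: is_derive_eq D _; rewrite -/y; ring.
  apply: near_eq_is_derive D0.
  near=> s; rewrite /flat_exp; suff -> : 0 < s by [].
  by near: s; exact: lt_nbhsr.
- rewrite {2}/flat_exp ltxx.
  have [K K0 pK] := flat_exp_le p 2.
  have lim0 : h^-1 *: (flat_exp p (h *: 1 + 0) - flat_exp p 0) @[h --> 0^'] --> (0 : R).
    apply/cvgr0Pnorm_le => e e0; near=> h.
    have h0 : h != 0 by near: h; exact: nbhs_dnbhs_neq.
    rewrite addr0 /GRing.scale/= mulr1 [flat_exp p 0]/flat_exp ltxx subr0.
    rewrite normrM normfV ler_pdivrMl ?normr_gt0//.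
    have [h_ge0|h_lt0] := leP 0 h.
      rewrite (le_trans (pK _ h_ge0))// ger0_norm// expr2 mulrA.
      rewrite [leRHS]mulrC ler_wpM2r//.
      have : `|h| <= e / (K + 1).
        near: h; apply: dnbhs0_le; first by rewrite divr_gt0// ltr_wpDl.
      rewrite ger0_norm// ler_pdivlMr ?ltr_wpDl//; apply: le_trans.
      by rewrite mulrC ler_wpM2l// lerDl.
    by rewrite /flat_exp ltNge (ltW h_lt0)/= normr0 mulr_ge0// ltW.
  apply: DeriveDef; first by apply/cvg_ex; exists 0.
  exact: cvg_lim lim0.
Unshelve. all: by end_near. Qed.

End flat_exponential.

Section iterated_derivatives.
Context {R : realType}.
Implicit Types (f g : R -> R) (n : nat).

(** Iterated differentiability peeled from the inside, so that the product rule
    can be used inductively. *)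
Fixpoint derivable_n n f : Prop :=
  (forall t, derivable f t 1) /\ if n is m.+1 then derivable_n m (derive1 f) else True.

Lemma derivable_nP f :
  (forall k t, derivable (derive1n k f) t 1) <-> (forall n, derivable_n n f).
Proof.
split=> [df n|df k].
  elim: n f df => [|n IHn] f df; split=> //; try exact: (df 0).
  by apply: IHn => k t; have := df k.+1 t; rewrite derive1Sn.
elim: k f df => [|k IHk] f df t; first by case: (df 0).
by rewrite derive1Sn; apply: IHk => n; case: (df n.+1).
Qed.

Lemma derivable_n1 n f t : derivable_n n f -> derivable f t 1.
Proof. by case: n => [|n] []. Qed.

Lemma derivable_nW n f : derivable_n n.+1 f -> derivable_n n f.
Proof.
elim: n f => [|n IHn] f [df df']; split=> //.
exact: IHn.
Qed.

Lemma derivable_nD n f g : derivable_n n f -> derivable_n n g ->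
  derivable_n n (f + g).
Proof.
elim: n f g => [|n IHn] f g [df df'] [dg dg'].
  by split; last by []; move=> t; exact: derivableD (df t) (dg t).
split=> [t|]; first exact: derivableD (df t) (dg t).
rewrite (_ : (derive1 (f + g)) = (derive1 f) + (derive1 g)); first exact: IHn.
by apply/funext => t; rewrite derive1E (deriveD (df t) (dg t)) fctE !derive1E.
Qed.

Lemma derive1_mul f g : (forall t, derivable f t 1) ->
  (forall t, derivable g t 1) -> (derive1 (f * g)) = f * (derive1 g) + g * (derive1 f).
Proof.
by move=> df dg; apply/funext => t; rewrite derive1E (deriveM (df t) (dg t)) -!derive1E.
Qed.

Lemma derivable_nM n f g : derivable_n n f -> derivable_n n g ->
  derivable_n n (f * g).
Proof.
elim: n f g => [|n IHn] f g Df Dg.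
  split; last by [].
  by move=> t; apply: derivableM; [exact: derivable_n1 Df|exact: derivable_n1 Dg].
split=> [t|].
  by apply: derivableM; [exact: derivable_n1 Df|exact: derivable_n1 Dg].
rewrite derive1_mul; [|by move=> t; exact: derivable_n1 Df|
  by move=> t; exact: derivable_n1 Dg].
by apply: derivable_nD; apply: IHn; [exact: derivable_nW|by case: Dg|
  exact: derivable_nW|by case: Df].
Qed.

Lemma is_derive_affine f (a b c t : R) : (forall t, derivable f t 1) ->
  is_derive t 1 (fun s => c * f (a * s + b)) (c * a * (derive1 f) (a * t + b)).
Proof.
move=> df.
have D1 : is_derive t 1 (fun s => a * s + b) a.
  have := is_deriveD (is_deriveZ a (is_derive_id t (1 : R))) (is_derive_cst b t 1).
  by rewrite addr0 /GRing.scale/= mulr1.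
have D2 : is_derive (a * t + b) 1 f ((derive1 f) (a * t + b)).
  by rewrite derive1E; exact: derivableP.
have D3 := @is_derive1_comp _ f (fun s => a * s + b) t _ _ D2 D1.
by rewrite -mulrA (mulrC a); exact: (is_deriveZ c D3).
Qed.

Lemma derivable_n_affine n f (a b c : R) : derivable_n n f ->
  derivable_n n (fun s => c * f (a * s + b)).
Proof.
elim: n f c => [|n IHn] f c [df df'];
  (split; first by move=> t; have /@ex_derive := is_derive_affine a b c t df) => //.
rewrite (_ : (derive1 _) = fun t => (c * a) * (derive1 f) (a * t + b)); first exact: IHn.
apply/funext => t; rewrite derive1E.
by have D := is_derive_affine a b c t df; rewrite derive_val.
Qed.

Lemma derive1_flat_exp (p : {poly R}) :
  (derive1 (flat_exp p)) = flat_exp (flat_exp_deriv p).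
Proof.
apply/funext => t; rewrite derive1E.
by have D := is_derive_flat_exp p t; rewrite derive_val.
Qed.

Lemma derivable_n_flat_exp n (p : {poly R}) : derivable_n n (flat_exp p).
Proof.
elim: n p => [|n IHn] p; (split; first by move=> t;
  have /@ex_derive := is_derive_flat_exp p t) => //.
by rewrite derive1_flat_exp.
Qed.

End iterated_derivatives.

Section cutoff.
Context {R : realType}.
Implicit Types (T A t : R).

Definition smooth_step t : R := flat_exp 1 t.

Lemma smooth_step0 t : t <= 0 -> smooth_step t = 0.
Proof. by move=> t0; rewrite /smooth_step /flat_exp ltNge t0. Qed.

Lemma smooth_step_ge0 t : 0 <= smooth_step t.
Proof.
rewrite /smooth_step /flat_exp; case: ifP => // _.
by rewrite hornerC mul1r expR_ge0.
Qed.

Lemma smooth_step_le1 t : smooth_step t <= 1.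
Proof.
rewrite /smooth_step /flat_exp; case: ifP => // t0.
by rewrite hornerC mul1r expR_le1 oppr_le0 invr_ge0 ltW.
Qed.

Lemma smooth_step_near1 A t : 0 < A -> A <= t -> 1 - A^-1 <= smooth_step t.
Proof.
move=> A0 At; have t0 : 0 < t by exact: lt_le_trans At.
rewrite /smooth_step /flat_exp t0 hornerC mul1r.
rewrite (le_trans _ (expR_ge1Dx _))// lerD2l lerN2 lef_pV2//.
Qed.

Lemma derive1_smooth_stepE t : (derive1 smooth_step) t = flat_exp 'X^2 t.
Proof.
rewrite (_ : smooth_step = flat_exp 1)// derive1_flat_exp /flat_exp_deriv.
by rewrite derivC subr0 mulr1.
Qed.

Lemma derive1_smooth_step_ge0 t : 0 <= (derive1 smooth_step) t.
Proof.
rewrite derive1_smooth_stepE /flat_exp; case: ifP => // t0.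
by rewrite hornerXn mulr_ge0 ?exprn_ge0 ?expR_ge0// invr_ge0 ltW.
Qed.

Lemma derive1_smooth_step_le2 t : (derive1 smooth_step) t <= 2.
Proof.
rewrite derive1_smooth_stepE /flat_exp; case: ifP => // t0.
rewrite hornerXn expRN ler_pdivrMr ?expR_gt0//.
have V0 : 0 <= t^-1 by rewrite invr_ge0 ltW.
by have := expR_ge1Dxn 1%N V0; rewrite /= !factS fact0 !muln1; move: (expR _) => e; lra.
Qed.

Lemma derive1_smooth_step_far A t : 1 <= A -> A <= t ->
  (derive1 smooth_step) t <= A^-1.
Proof.
move=> A1 At; have A0 : 0 < A by exact: lt_le_trans A1.
have t0 : 0 < t by exact: lt_le_trans At.
have tV0 : 0 < t^-1 by rewrite invr_gt0.
have tA : t^-1 <= A^-1 by rewrite lef_pV2.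
have A1' : A^-1 <= 1 by rewrite invf_le1.
rewrite derive1_smooth_stepE /flat_exp t0 hornerXn.
have e1 : expR (- t^-1) <= 1 by rewrite expR_le1 oppr_le0 ltW.
have e0 := expR_ge0 (- t^-1).
apply: (@le_trans _ _ (t^-1 ^+ 2 * 1)); first by rewrite ler_wpM2l// exprn_ge0// ltW.
rewrite mulr1; nra.
Qed.

(** The plateau between two steps, one rising after time 1 and the other its
    mirror image falling before time [T - 1]. *)
Definition cutoff T t : R := smooth_step (t - 1) * smooth_step (T - 1 - t).

Let affE T : cutoff T =
  (fun t => 1 * smooth_step (1 * t + (- 1))) *
  (fun t => 1 * smooth_step ((- 1) * t + (T - 1))).
Proof.
by apply/funext => t; rewrite /cutoff !fctE !mul1r mulN1r [- t + _]addrC.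
Qed.

Lemma cutoff_test T : test_fun_itv T (cutoff T).
Proof.
split.
  apply/derivable_nP => n; rewrite affE.
  by apply: derivable_nM; apply: derivable_n_affine; exact: derivable_n_flat_exp.
have clos : closed `[1, T - 1]%classic by exact: itv_closed.
have sub : closure [set t | cutoff T t != 0] `<=` `[1, T - 1].
  rewrite [X in _ `<=` X]((closure_id _).1 clos).
  apply: closure_subset => t /=.
  rewrite in_itv /= mulf_eq0 negb_or => /andP[].
  have [t1|t1] := leP 1 t; last by rewrite smooth_step0 ?eqxx// subr_le0 ltW.
  have [//|tT] := leP t (T - 1).
  by rewrite [smooth_step (T - 1 - t)]smooth_step0 ?eqxx// subr_le0 ltW.
apply: (subset_trans sub) => t /=; rewrite !in_itv/= => /andP[? ?].
by apply/andP; split; lra.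
Qed.

Lemma derive1_cutoff T t : (derive1 (cutoff T)) t =
  (derive1 smooth_step) (t - 1) * smooth_step (T - 1 - t) -
  smooth_step (t - 1) * (derive1 smooth_step) (T - 1 - t).
Proof.
have ds s : derivable smooth_step s 1.
  exact: derivable_n1 (derivable_n_flat_exp 0 1).
rewrite affE derive1_mul; last 2 first.
- by move=> s; have /@ex_derive := is_derive_affine 1 (-1) 1 s ds.
- by move=> s; have /@ex_derive := is_derive_affine (-1) (T - 1) 1 s ds.
have D1 := is_derive_affine 1 (-1) 1 t ds.
have D2 := is_derive_affine (-1) (T - 1) 1 t ds.
rewrite !fctE [in LHS]derive1E derive_val [X in _ + _ * X]derive1E derive_val.
rewrite !mul1r !mulN1r [- t + _]addrC mulrN [LHS]addrC; congr (_ - _).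
exact: mulrC.
Qed.

Lemma cutoff_le1 T t : cutoff T t <= 1.
Proof. by rewrite mulr_ile1 ?smooth_step_ge0 ?smooth_step_le1. Qed.

Lemma derive1_cutoff_le T t : (derive1 (cutoff T)) t ^+ 2 <= 4.
Proof.
rewrite derive1_cutoff.
have := derive1_smooth_step_ge0 (t - 1); have := derive1_smooth_step_le2 (t - 1).
have := derive1_smooth_step_ge0 (T - 1 - t).
have := derive1_smooth_step_le2 (T - 1 - t).
have := smooth_step_ge0 (t - 1); have := smooth_step_le1 (t - 1).
have := smooth_step_ge0 (T - 1 - t); have := smooth_step_le1 (T - 1 - t).
move: (smooth_step _) (smooth_step _) (derive1 smooth_step _) (derive1 smooth_step _).
move=> a b c e ? ? ? ? ? ? ? ?.
have ? : 0 <= e * a <= 2 by apply/andP; split; nra.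
have ? : 0 <= b * c <= 2 by apply/andP; split; nra.
nra.
Qed.

Lemma cutoff_plateau A T t : 1 <= A -> A + 1 <= t <= T - (A + 1) ->
  1 - 2 / A <= cutoff T t /\ (derive1 (cutoff T)) t ^+ 2 <= A^-1.
Proof.
move=> A1 /andP[At tA].
have A0 : 0 < A by exact: lt_le_trans A1.
have At1 : A <= t - 1 by lra.
have At2 : A <= T - 1 - t by lra.
have A1' : A^-1 <= 1 by rewrite invf_le1.
have AV0 : 0 <= A^-1 by rewrite invr_ge0 ltW.
rewrite derive1_cutoff /cutoff.
have := smooth_step_near1 A0 At1; have := smooth_step_near1 A0 At2.
have := derive1_smooth_step_ge0 (t - 1).
have := derive1_smooth_step_far A1 At1.
have := derive1_smooth_step_ge0 (T - 1 - t).
have := derive1_smooth_step_far A1 At2.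
have := smooth_step_ge0 (t - 1); have := smooth_step_le1 (t - 1).
have := smooth_step_ge0 (T - 1 - t); have := smooth_step_le1 (T - 1 - t).
move: (smooth_step _) (smooth_step _) (derive1 smooth_step _) (derive1 smooth_step _).
move: A1' AV0; move: (A^-1) => v ? ? a b c e ? ? ? ? ? ? ? ? ? ?.
split; first by nra.
have ? : 0 <= e * a <= v by apply/andP; split; nra.
have ? : 0 <= b * c <= v by apply/andP; split; nra.
nra.
Qed.

End cutoff.

(** * Measurability of continuous functions of several variables *)

Section borel_rV.
Context {R : realType} {d : nat}.
Implicit Types (x : 'rV[R]_d).

Lemma measurable_ball_rV x (r : R) : 0 < r -> measurable (ball x r).
Proof.
move=> r0.
rewrite (_ : ball x r = \bigcap_(i in [set: 'I_d])
    ((fun y : 'rV[R]_d => y 0 i : measurableTypeR R) @^-1` ball (x 0 i) r)).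
  apply: fin_bigcap_measurable => // i _.
  rewrite -[X in measurable X]setTI; apply: measurable_coord => //.
  by rewrite ball_itv.
apply/seteqP; split=> [y [_ xy] i _|y xy]; first exact: xy.
by split=> // j i; rewrite ord1; exact: xy.
Qed.

(** Balls with rational centre and radius [1 / (k + 1)] generate the topology,
    so the product sigma-algebra contains all open sets. *)
Lemma open_measurable_rV (O : set 'rV[R]_d) : open O -> measurable O.
Proof.
move=> oO.
pose c (p : 'rV[rat]_d * nat) : 'rV[R]_d := \row_i ratr (p.1 0 i).
pose B p := ball (c p) p.2.+1%:R^-1.
rewrite (_ : O = \bigcup_p (if `[< B p `<=` O >] then B p else set0)).
  apply: countable_bigcupT_measurable => // p; case: ifP => // _.
  exact: measurable_ball_rV.
apply/seteqP; split=> [x Ox|x [p _]]; last first.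
  by case: asboolP => // BO; exact: BO.
have /nbhs_ballP[e /= e0 xeO] := open_nbhs_nbhs (conj oO Ox).
pose k := Num.trunc (2 / e).
have kV0 : 0 < k.+1%:R^-1 :> R by rewrite invr_gt0.
have ke : 2 / k.+1%:R < e.
  rewrite ltr_pdivrMr// -ltr_pdivrMl// mulrC.
  by rewrite truncnS_gt.
have q_ i : exists q : rat, `|x 0 i - ratr q| < k.+1%:R^-1.
  have /rat_in_itvoo[q /itvP qx] : x 0 i - k.+1%:R^-1 < x 0 i + k.+1%:R^-1.
    by rewrite ltrBlDr -addrA ltrDl addr_gt0.
  by exists q; rewrite ltr_distlC !qx.
pose q := \row_i projT1 (cid (q_ i)).
have xq : ball (c (q, k)) k.+1%:R^-1 x.
  split=> // j i; rewrite ord1 /= /c !mxE.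
  by rewrite /ball /= distrC; exact: (projT2 (cid (q_ i))).
exists (q, k) => //; case: asboolP => // nBO; exfalso; apply: nBO => y qy.
apply: xeO; apply: (le_ball (ltW ke)).
rewrite (_ : 2 / _ = k.+1%:R^-1 + k.+1%:R^-1); last by rewrite mulr_natl.
by apply: ball_triangle qy; exact: ball_sym.
Qed.

Lemma continuous_measurable_rV (f : 'rV[R]_d -> R) : continuous f ->
  measurable_fun [set: 'rV[R]_d] (f : 'rV[R]_d -> measurableTypeR R).
Proof.
move=> /continuousP cf; apply: (measurability _ (RGenOpens.measurableE R)).
move=> _ [_ [a [b ->]] <-]; rewrite setTI.
by apply: open_measurable_rV; apply: cf; exact: interval_open.
Qed.

Lemma measurable_fun_comp_rV (f : 'rV[R]_d -> R) (D : set R)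
    (v : R -> 'rV[R]_d) : continuous f ->
  measurable D ->
  (forall i, measurable_fun D (fun t => v t 0 i)) ->
  measurable_fun D (fun t => f (v t)).
Proof.
move=> cf mD mv.
pose w t : 'rV[R]_d := \row_i ((fun t => v t 0 i) \_ D) t.
apply: (@eq_measurable_fun _ _ _ _ _ (f \o w)).
  move=> t tD; rewrite /= /w; congr f; apply/rowP => i.
  by rewrite mxE patchE tD.
apply: (@measurable_funS _ _ _ _ setT) => //.
apply: (measurableT_comp (continuous_measurable_rV cf)).
apply: measurable_fun_rV => i.
under eq_fun do rewrite mxE.
exact: (measurable_restrictT _ mD).1 (mv i).
Qed.

End borel_rV.

(** * Test functions and functions with zero boundary values *)

Section open_interval.
Context {R : realType}.
Variable T : R.
Hypothesis T0 : 0 < T.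
Notation mu := (@lebesgue_measure R).
Implicit Types (f g phi psi : R -> R).

Lemma continuous_integrable_oo f : continuous f ->
  mu.-integrable `]0, T[ (EFin \o f).
Proof.
move=> cf; apply: (@integrableS _ _ _ mu `[0, T]) => //.
  exact: subset_itv_oo_cc.
apply: continuous_compact_integrable; first exact: segment_compact.
exact: continuous_subspaceT.
Qed.

Lemma Rintegral_cst_oo (a : R) : \int[mu]_(t in `]0, T[) a = a * T.
Proof. by rewrite Rintegral_cst//= lebesgue_measure_itv/= lte_fin T0 -EFinB subr0. Qed.

Lemma integrable_cst_oo (a : R) : mu.-integrable `]0, T[ (EFin \o cst a).
Proof. by apply: continuous_integrable_oo => t; exact: cvg_cst. Qed.

Section test.
Variable phi : R -> R.
Hypothesis tphi : test_fun_itv T phi.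

Lemma test_fun_derivable t : derivable phi t 1.
Proof. exact: (tphi.1 0%N). Qed.

Lemma test_fun_continuous : continuous phi.
Proof.
by move=> t; apply: differentiable_continuous; apply/derivable1_diffP;
  exact: test_fun_derivable.
Qed.

Lemma test_fun_continuous_derive1 : continuous (derive1 phi).
Proof.
by move=> t; apply: differentiable_continuous; apply/derivable1_diffP;
  exact: (tphi.1 1%N).
Qed.

Lemma test_fun0 t : t <= 0 \/ T <= t -> phi t = 0.
Proof.
move=> tT; apply/eqP/negPn/negP => phit.
have /tphi.2 : closure [set t | phi t != 0] t by exact: subset_closure.
by rewrite /= in_itv/= => /andP[]; case: tT; lra.
Qed.

Lemma test_fun_LRcontinuous : derivable_oo_LRcontinuous phi 0 T.
Proof.
split=> [t _||]; first exact: test_fun_derivable.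
- by apply: cvg_at_right_filter; exact: test_fun_continuous.
- by apply: cvg_at_left_filter; exact: test_fun_continuous.
Qed.

Lemma integral_derive1_test_fun : \int[mu]_(t in `]0, T[) derive1 phi t = 0.
Proof.
have ip := continuous_integrable_oo test_fun_continuous_derive1.
rewrite /Rintegral -(@integral_itv_bndoo _ _ _ _ true false); last exact: measurable_int ip.
have p0 : phi 0 = 0 by apply: test_fun0; left.
have pT : phi T = 0 by apply: test_fun0; right.
rewrite (@continuous_FTC2 _ _ phi)//; first by rewrite p0 pT subee.
- exact: continuous_subspaceT test_fun_continuous_derive1.
- exact: test_fun_LRcontinuous.
Qed.

End test.

Lemma test_fun_weak_deriv phi : test_fun_itv T phi ->
  weak_deriv_itv T phi (derive1 phi).
Proof.
move=> tphi psi tpsi.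
have cM f g : continuous f -> continuous g -> continuous (fun t => f t * g t).
  by move=> cf cg t; apply: cvgM; [exact: cf|exact: cg].
have cc f : continuous f -> \int[mu]_(t in `]0, T[) f t = \int[mu]_(t in `[0, T]) f t.
  move=> cf; rewrite /Rintegral -(@integral_itv_bndoo _ _ _ _ true false)//.
  exact: measurable_int (continuous_integrable_oo cf).
have c1 := test_fun_continuous tphi; have c2 := test_fun_continuous_derive1 tphi.
have c3 := test_fun_continuous tpsi; have c4 := test_fun_continuous_derive1 tpsi.
rewrite !cc; [|exact: cM..].
rewrite (@Rintegration_by_parts _ phi psi (derive1 phi) (derive1 psi))//.
- rewrite (test_fun0 tphi); last by right.
  by rewrite (test_fun0 tphi); [rewrite !mul0r subr0 add0r|left].
- exact: continuous_subspaceT.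
- exact: test_fun_LRcontinuous.
- exact: continuous_subspaceT.
- exact: test_fun_LRcontinuous.
Qed.

Lemma continuous_L2_itv f : continuous f -> L2_itv T f.
Proof.
move=> cf; split.
  by apply/measurable_EFinP; exact: measurable_int (continuous_integrable_oo cf).
have cf2 : continuous (fun t => f t ^+ 2).
  by move=> t; apply: cvgM; exact: cf.
have /integrableP[_] := continuous_integrable_oo cf2.
apply: le_lt_trans; rewrite le_eqVlt; apply/orP; left; apply/eqP.
by apply: eq_integral => t _ /=; rewrite ger0_norm// sqr_ge0.
Qed.

Lemma test_fun_H10 phi : test_fun_itv T phi -> H10_itv T phi (derive1 phi).
Proof.
move=> tphi; split.
- exact/continuous_L2_itv/test_fun_continuous.
- exact/continuous_L2_itv/test_fun_continuous_derive1.
- exact: test_fun_weak_deriv.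
- exists (fun=> phi); split=> //.
  + rewrite (_ : (fun _ => _) = cst 0%E); first exact: cvg_cst.
    apply/funext => k; apply: integral0_eq => t _.
    by rewrite subrr expr0n.
  + rewrite (_ : (fun _ => _) = cst 0%E); first exact: cvg_cst.
    apply/funext => k; apply: integral0_eq => t _.
    by rewrite subrr expr0n.
Qed.

Lemma L2_itv_sqr_integrable f : L2_itv T f ->
  mu.-integrable `]0, T[ (EFin \o (fun t => f t ^+ 2)).
Proof.
move=> [mf f2]; apply/integrableP; split.
  by apply/measurable_EFinP; exact: measurable_funX.
apply: le_lt_trans f2; rewrite le_eqVlt; apply/orP; left; apply/eqP.
by apply: eq_integral => t _ /=; rewrite ger0_norm// sqr_ge0.
Qed.

Lemma L2_itv_integrable f : L2_itv T f -> mu.-integrable `]0, T[ (EFin \o f).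
Proof.
move=> Lf; have := L2_itv_sqr_integrable Lf => if2.
apply: (@le_integrable _ _ _ mu _ _ _ (EFin \o (fun t => 1 + f t ^+ 2))) => //.
- by apply/measurable_EFinP; case: Lf.
- move=> t _ /=; rewrite lee_fin [leRHS]ger0_norm; last by rewrite addr_ge0// sqr_ge0.
  rewrite -[f t ^+ 2]real_normK ?num_real//.
  by move: (normr_ge0 (f t)); move: `|f t| => x; nra.
- exact: (integrableD _ (integrable_cst_oo 1) if2).
Qed.

(** A zero boundary value is recorded only through approximation by test
    functions; it is used through the vanishing of the mean of the derivative,
    and [|x| <= s + x ^ 2 / s] lets the approximation in square norm pass to
    the mean. *)
Lemma H10_itv_integral0 f g : H10_itv T f g ->
  \int[mu]_(t in `]0, T[) g t = 0.
Proof.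
case=> _ Lg _ [phi [tphi _ phig]].
have ig := L2_itv_integrable Lg.
have key s : 0 < s -> `|\int[mu]_(t in `]0, T[) g t| <= s * T + s.
  move=> s0.
  have /fine_cvgP[fin /cvgr_lt/(_ (s ^+ 2))] := phig.
  rewrite exprn_gt0// => /(_ isT) small.
  have [k _ kP] : (\forall k \near \oo, (\int[mu]_(t in `]0%R, T[)
     ((derive1 (phi k) t - g t) ^+ 2)%:E)%E \is a fin_num /\
     fine (\int[mu]_(t in `]0%R, T[)
     ((derive1 (phi k) t - g t) ^+ 2)%:E)%E < s ^+ 2).
    by near=> k; split; near: k.
  have [fink smallk] := kP k (leqnn k).
  pose h t := derive1 (phi k) t - g t.
  have ip : mu.-integrable `]0, T[ (EFin \o derive1 (phi k)).
    exact: continuous_integrable_oo (test_fun_continuous_derive1 (tphi k)).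
  have ih : mu.-integrable `]0, T[ (EFin \o h) by exact: (integrableB _ ip ig).
  have mh : measurable_fun `]0, T[ h.
    by apply/measurable_EFinP; exact: measurable_int ih.
  have Lh : L2_itv T h by split=> //; rewrite ltey_eq fink.
  have ih2 := L2_itv_sqr_integrable Lh.
  have -> : \int[mu]_(t in `]0, T[) g t = - \int[mu]_(t in `]0, T[) h t.
    rewrite /h RintegralB// integral_derive1_test_fun//.
    by rewrite sub0r opprK.
  rewrite normrN (le_trans (le_normr_Rintegral _ ih))//.
  have ihs : mu.-integrable `]0, T[ (EFin \o (fun t => s^-1 * h t ^+ 2)).
    exact: (integrableZl _ s^-1 ih2).
  apply: (@le_trans _ _ (\int[mu]_(t in `]0, T[) (s + s^-1 * h t ^+ 2))).
    apply: le_Rintegral => //.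
    - exact: integrable_norm.
    - exact: (integrableD _ (integrable_cst_oo s) ihs).
    move=> t _; rewrite -[h t ^+ 2]real_normK ?num_real//.
    rewrite -(ler_pM2l s0) mulrDr mulrA divff ?gt_eqF// mul1r.
    by move: (normr_ge0 (h t)) s0; move: `|h t| => x; nra.
  rewrite RintegralD//; last exact: integrable_cst_oo.
  rewrite Rintegral_cst_oo lerD2l RintegralZl// ler_pdivrMl//.
  by rewrite -expr2 ltW.
apply/eqP; rewrite -normr_eq0 eq_le normr_ge0 andbT.
apply/ler_addgt0Pl => e e0; rewrite addr0.
have T1 : 0 < T + 1 by rewrite addr_gt0.
apply: (le_trans (key (e / (T + 1)) _)); first by rewrite divr_gt0.
by rewrite le_eqVlt; apply/orP; left; apply/eqP; field; rewrite gt_eqF.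
Unshelve. all: by end_near. Qed.

End open_interval.

(** * The effective Lagrangian *)

Lemma integrable_Rintegral_sum d (T : measurableType d) (R : realType)
    (mu : {measure set T -> \bar R}) (I : Type) (s : seq I) (D : set T)
    (h : I -> T -> R) : measurable D ->
  (forall i, mu.-integrable D (EFin \o h i)) ->
  mu.-integrable D (EFin \o (fun t => \sum_(i <- s) h i t)) /\
  \int[mu]_(t in D) (\sum_(i <- s) h i t) = \sum_(i <- s) \int[mu]_(t in D) h i t.
Proof.
move=> mD ih; elim: s => [|i s [is_ Es]].
  rewrite big_nil (_ : (fun t => _) = cst 0); last first.
    by apply/funext => t; rewrite big_nil.
  split; last by rewrite Rintegral_cst// mul0r.
  exact: integrable0.
rewrite big_cons (_ : (fun t => _) = (fun t => h i t + \sum_(i <- s) h i t)).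
  by rewrite RintegralD// Es; split=> //; exact: (integrableD mD (ih i) is_).
by apply/funext => t; rewrite big_cons.
Qed.

Section cell_problem.
Context {R : realType} {d : nat}.
Notation mu := (@lebesgue_measure R).
Variables (V : 'rV[R]_d -> R) (m M : R).
Hypotheses (cV : continuous V) (Vm : forall x, m <= V x) (VM : forall x, V x <= M).

(** The cross term [2 xi . v'] in [|v' + xi|^2] has zero integral, and
    [|v'|^2] is dropped. *)
Lemma cell_energy_ge (T : R) (xi : 'rV[R]_d) (e : R) : 0 < T ->
  cell_energies V T xi e -> T * (dot xi xi + m) <= e.
Proof.
move=> T0 [v [v' [vv' ->]]].
pose D : set R := `]0, T[%classic.
have mD : measurable (D : set (measurableTypeR R)) by exact: measurable_itv.
have Lv' i : L2_itv T (fun t => v' t 0 i) by case: (vv' i).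
have iv' i : mu.-integrable D (EFin \o (fun t => v' t 0 i)).
  exact: L2_itv_integrable.
have icst (a : R) : mu.-integrable D (EFin \o cst a) by exact: integrable_cst_oo.
pose lin (t : R) : R := \sum_(i < d) (2 * xi 0 i) * v' t 0 i.
have ili i : mu.-integrable D (EFin \o (fun t => (2 * xi 0 i) * v' t 0 i)).
  exact: (integrableZl mD (2 * xi 0 i) (iv' i)).
have [ilin lin0] : mu.-integrable D (EFin \o lin) /\ \int[mu]_(t in D) lin t = 0.
  have [ilin ->] := integrable_Rintegral_sum (index_enum 'I_d) mD ili.
  split=> //; apply: big1 => i _.
  by rewrite RintegralZl// (H10_itv_integral0 T0 (vv' i)) mulr0.
have ikin : mu.-integrable D (EFin \o (fun t => enorm (v' t + xi) ^+ 2)).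
  rewrite (_ : (fun t => enorm _ ^+ 2) =
      (fun t => \sum_(i < d) (v' t 0 i + xi 0 i) ^+ 2)); last first.
    apply/funext => t; rewrite sqr_enorm /dot.
    by apply: eq_bigr => i _; rewrite !mxE expr2.
  apply: (integrable_Rintegral_sum (index_enum 'I_d) mD _).1 => i.
  have i2 := L2_itv_sqr_integrable (Lv' i).
  rewrite (_ : _ \o _ = fun t => (((v' t 0 i) ^+ 2)%:E +
     (((2 * xi 0 i) * v' t 0 i)%:E + (xi 0 i ^+ 2)%:E))%E).
    exact: (integrableD mD i2 (integrableD mD (ili i) (icst (xi 0 i ^+ 2)))).
  by apply/funext => t /=; rewrite -!EFinD; congr (_%:E); ring.
have ipot : mu.-integrable D (EFin \o (fun t => V (v t + t *: xi))).
  apply: (@le_integrable _ _ _ mu _ _ _ (EFin \o cst (`|m| + `|M|))) => //.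
    apply/measurable_EFinP; apply: measurable_fun_comp_rV => // i.
    have [[mv _] _ _ _] := vv' i.
    apply: (@eq_measurable_fun _ _ _ _ _ (fun t => v t 0 i + t * xi 0 i)).
      by move=> t _; rewrite !mxE.
    by apply: measurable_funD => //; apply: measurable_funM.
  move=> t _ /=; rewrite lee_fin [leRHS]ger0_norm ?addr_ge0//.
  have := Vm (v t + t *: xi); have := VM (v t + t *: xi).
  move: (V _) => y yM my; rewrite ler_norml; apply/andP; split.
    rewrite lerNl; have := ler_norm (- m); rewrite normrN.
    by have := normr_ge0 M; lra.
  by have := ler_norm M; have := normr_ge0 m; lra.
rewrite mulrC -Rintegral_cst_oo//.
have -> : \int[mu]_(t in D) (dot xi xi + m) =
    \int[mu]_(t in D) ((dot xi xi + m) + lin t).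
  by rewrite [RHS](RintegralD mD (icst _) ilin) lin0 addr0.
apply: (le_Rintegral mD (integrableD mD (icst _) ilin) (integrableD mD ikin ipot)).
move=> t _; rewrite addrAC lerD//.
rewrite sqr_enorm /lin /dot -big_split/=.
by apply: ler_sum => i _; rewrite !mxE; nra.
Qed.

Lemma test_fun_itvZ (T c : R) (phi : R -> R) : test_fun_itv T phi ->
  test_fun_itv T (fun t => c * phi t).
Proof.
move=> [dphi sphi]; split.
  apply/derivable_nP => n; rewrite (_ : (fun t => _) = fun t => c * phi (1 * t + 0)).
    by apply: derivable_n_affine; move: n; exact/derivable_nP.
  by apply/funext => t; rewrite mul1r addr0.
apply: subset_trans sphi; apply: closure_subset => t /=.
by apply: contra => /eqP->; rewrite mulr0.
Qed.

Lemma derive1_scale (c : R) (phi : R -> R) t : derivable phi t 1 ->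
  derive1 (fun t => c * phi t) t = c * derive1 phi t.
Proof. by move=> dphi; rewrite !derive1E; exact: (deriveZ c dphi). Qed.

Lemma cell_energy_cutoff (T : R) (z : 'rV[R]_d) : 0 < T ->
  cell_energies V T 0 (\int[mu]_(t in `]0, T[)
    (derive1 (cutoff T) t ^+ 2 * dot z z + V (cutoff T t *: z))).
Proof.
move=> T0; have tc := cutoff_test T.
exists (fun t => cutoff T t *: z), (fun t => derive1 (cutoff T) t *: z); split.
  move=> i.
  have -> : (fun t => (cutoff T t *: z) 0 i) = (fun t => z 0 i * cutoff T t).
    by apply/funext => t; rewrite !mxE mulrC.
  have -> : (fun t => (derive1 (cutoff T) t *: z) 0 i) =
      derive1 (fun t => z 0 i * cutoff T t).
    apply/funext => t; rewrite !mxE mulrC derive1_scale//.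
    exact: test_fun_derivable tc t.
  exact/test_fun_H10/test_fun_itvZ.
apply: eq_Rintegral => t _; rewrite addr0 sqr_enorm dotZZ scaler0 addr0.
by [].
Qed.

Lemma Rintegral_indic_le (D : set (measurableTypeR R)) (a b : R) :
  measurable D -> a <= b ->
  \int[mu]_(t in D) (\1_(`[a, b]%classic : set R) t : R) <= b - a.
Proof.
move=> mD ab.
have fab : mu `[a, b] = (b - a)%:E.
  rewrite lebesgue_measure_itv/= lte_fin; move: ab.
  by rewrite le_eqVlt => /orP[/eqP->|->]; rewrite ?ltxx ?subrr ?EFinB.
have le1 : (mu (`[a, b] `&` D) <= mu `[a, b])%E.
  by apply: le_measure; [rewrite inE; exact: measurableI|rewrite inE|exact: subIsetl].
rewrite /Rintegral integral_indic// -[leRHS]/(fine (b - a)%:E) -fab fine_le//.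
  by rewrite ge0_fin_numE// (le_lt_trans le1)// fab ltry.
by rewrite fab.
Qed.

(** The curve [cutoff T t *: z] rests close to [z] except during times that do
    not depend on [T] at both ends. *)
Lemma cell_energy_cutoff_le (z : 'rV[R]_d) (delta : R) : V z = m -> 0 < delta ->
  exists C, forall T, 0 < T -> \int[mu]_(t in `]0, T[)
    (derive1 (cutoff T) t ^+ 2 * dot z z + V (cutoff T t *: z)) <=
    (m + delta) * T + C.
Proof.
move=> Vz delta0.
have cG : continuous (fun s : R => V (s *: z)).
  move=> s; apply: continuous_comp; last exact: cV.
  exact: scalel_continuous.
have delta20 : 0 < delta / 2 by rewrite divr_gt0.
have /cvgrPdist_le/(_ _ delta20) := cG 1.
rewrite scale1r Vz => /nbhs_ballP[eta /= eta0 etaP].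
pose Dz := dot z z.
have Dz0 : 0 <= Dz by exact: dot_ge0.
(* On the plateau the cutoff is within 2 / A of 1, where the potential exceeds
   m by at most delta / 2, and the kinetic term is at most Dz / A. *)
pose A := 1 + 4 / eta + 2 * Dz / delta.
have q1 : 0 < 4 / eta by rewrite divr_gt0.
have q2 : 0 <= 2 * Dz / delta by rewrite divr_ge0 ?mulr_ge0// ltW.
have A1 : 1 <= A by rewrite /A; lra.
have A0 : 0 < A by exact: lt_le_trans A1.
have A_eta : 2 / A < eta.
  rewrite ltr_pdivrMr//; have : eta * (4 / eta) = 4 by field; rewrite gt_eqF.
  rewrite /A; move: q1 q2 eta0; move: (4 / eta) (2 * Dz / delta) => a b; nra.
have A_Dz : A^-1 * Dz <= delta / 2.
  rewrite mulrC ler_pdivrMr//.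
  have : delta * (2 * Dz / delta) = 2 * Dz by field; rewrite gt_eqF.
  rewrite /A; move: q1 q2 delta0; move: (4 / eta) (2 * Dz / delta) => a b; nra.
have mM : m <= M by rewrite -Vz.
(* Bound for the excess over m at all times; it is paid for a time 2 * B. *)
pose K := 4 * Dz + (M - m).
have K0 : 0 <= K by rewrite /K; lra.
pose B := A + 1.
have B0 : 0 <= B by rewrite /B; lra.
exists (K * (B + B)) => T T0.
pose I1 : set R := `[0, B]%classic; pose I2 : set R := `[T - B, T]%classic.
have tc := cutoff_test T.
have cc := test_fun_continuous tc; have cc' := test_fun_continuous_derive1 tc.
have ih : mu.-integrable `]0, T[ (EFin \o (fun t : R =>
    derive1 (cutoff T) t ^+ 2 * dot z z + V (cutoff T t *: z))).
  apply: continuous_integrable_oo => // t; apply: cvgD.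
    by apply: cvgM; [apply: cvgM; exact: cc'|exact: cvg_cst].
  by apply: (@continuous_comp _ _ _ (cutoff T) (fun s => V (s *: z)));
    [exact: cc|exact: cG].
have iI (S : set (measurableTypeR R)) : measurable S ->
    mu.-integrable `]0, T[ (EFin \o (\1_S : R -> R)).
  move=> mS; apply: (@integrableS _ _ _ mu `[0, T]) => //.
    exact: subset_itv_oo_cc.
  apply: (@le_integrable _ _ _ mu _ _ _ (EFin \o cst 1)) => //.
  - by apply/measurable_EFinP; exact: measurable_indic.
  - by move=> t _ /=; rewrite lee_fin !normr1 indicE ger0_norm// lern1 leq_b1.
  - apply: continuous_compact_integrable; first exact: segment_compact.
    by apply: continuous_subspaceT => ?; exact: cvg_cst.
have mI1 : measurable (I1 : set (measurableTypeR R)) by exact: measurable_itv.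
have mI2 : measurable (I2 : set (measurableTypeR R)) by exact: measurable_itv.
have mD : measurable (`]0, T[%classic : set (measurableTypeR R)).
  exact: measurable_itv.
have iI12 : mu.-integrable `]0, T[ (EFin \o (fun t => \1_I1 t + \1_I2 t : R)).
  exact: (integrableD mD (iI _ mI1) (iI _ mI2)).
pose g (t : R) : R := K * (\1_I1 t + \1_I2 t).
have iK : mu.-integrable `]0, T[ (EFin \o g).
  exact: (integrableZl mD K iI12).
have iKm : mu.-integrable `]0, T[ (EFin \o (fun t => (m + delta) + g t)).
  exact: (integrableD mD (integrable_cst_oo T (m + delta)) iK).
apply: (@le_trans _ _ (\int[mu]_(t in `]0, T[) ((m + delta) + g t))).
  apply: le_Rintegral => //.
  move=> t; rewrite /g /= in_itv/= => /andP[t0 tT].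
  have c4 := derive1_cutoff_le T t.
  have VMt := VM (cutoff T t *: z).
  have rough : derive1 (cutoff T) t ^+ 2 * dot z z + V (cutoff T t *: z) <=
      m + delta + K.
    rewrite -/Dz /K; have : derive1 (cutoff T) t ^+ 2 * Dz <= 4 * Dz.
      by rewrite ler_wpM2r.
    by lra.
  have [tI1|tI1] := pselect (I1 t).
    apply: (le_trans rough); rewrite lerD2l ler_peMr//.
    by rewrite [\1_I1 t]indicE mem_set//= lerDl indicE ler0n.
  have [tI2|tI2] := pselect (I2 t).
    apply: (le_trans rough); rewrite lerD2l ler_peMr//.
    by rewrite [\1_I2 t]indicE mem_set//= lerDr indicE ler0n.
  rewrite !indicE !memNset// addr0 mulr0 addr0.
  have AtT : A + 1 <= t <= T - (A + 1).
    apply/andP; split; rewrite leNgt; apply/negP => tB.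
      by apply: tI1; rewrite /I1 /= in_itv/= (ltW t0) ltW.
    by apply: tI2; rewrite /I2 /= in_itv/= (ltW tT) andbT ltW.
  have [c1 c'1] := cutoff_plateau A1 AtT.
  have cle1 := cutoff_le1 T t.
  have : V (cutoff T t *: z) <= m + delta / 2.
    have : ball (1 : R) eta (cutoff T t).
      rewrite /ball /= ger0_norm; last by rewrite subr_ge0.
      by apply: le_lt_trans A_eta; lra.
    by move/etaP => /=; rewrite ler_norml => /andP[+ _]; lra.
  have : derive1 (cutoff T) t ^+ 2 * dot z z <= delta / 2.
    by apply: le_trans A_Dz; rewrite ler_wpM2r.
  by lra.
rewrite RintegralD//; last exact: integrable_cst_oo.
rewrite Rintegral_cst_oo// lerD2l RintegralZl// ler_wpM2l//.
rewrite RintegralD//; [|exact: iI..].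
apply: lerD.
  by have := Rintegral_indic_le mD B0; rewrite subr0.
have TB : T - B <= T by lra.
apply: (le_trans (Rintegral_indic_le mD TB)).
by lra.
Qed.

Section fhom.
Variables (f : 'rV[R]_d -> R).
Hypothesis f_hom : is_fhom V f.

Lemma fhom_ge xi : dot xi xi + m <= f xi.
Proof.
rewrite leNgt; apply/negP => fxi.
have /cvgr_lt/(_ _ fxi) small := @f_hom xi.
have : \forall T \near +oo, T^-1 * inf (cell_energies V T xi) < dot xi xi + m /\
    0 < T.
  by near=> T; split; near: T => //; apply: nbhs_pinfty_gt; exact: num_real.
move=> /filter_ex[T [infT T0]].
move: infT; rewrite ltNge ler_pdivlMl// => /negP; apply.
apply: lb_le_inf; last by move=> e; exact: cell_energy_ge.
(* The null curve is admissible, so that the infimum is over a nonempty set. *)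
have H0 : H10_itv T (fun=> 0) (fun=> 0 : R).
  have := test_fun_H10 T0 (test_fun_itvZ 0 (cutoff_test T)).
  congr (H10_itv T _ _); apply/funext => t; first by rewrite mul0r.
  rewrite derive1_scale ?mul0r//; exact: test_fun_derivable (cutoff_test T) t.
exists (\int[mu]_(t in `]0, T[) (enorm (0 + xi) ^+ 2 + V (0 + t *: xi))).
by exists (fun=> 0), (fun=> 0); split=> // i; under eq_fun do rewrite mxE.
Unshelve. all: by end_near. Qed.

Lemma fhom0_le z : V z = m -> f 0 <= m.
Proof.
move=> Vz; rewrite leNgt; apply/negP => f0.
pose delta := (f 0 - m) / 3.
have delta0 : 0 < delta by rewrite divr_gt0// subr_gt0.
have [C CP] := cell_energy_cutoff_le Vz delta0.
have fd : m + 2 * delta < f 0 by rewrite /delta; lra.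
have /cvgr_gt/(_ _ fd) large := @f_hom 0.
have : \forall T \near +oo, [/\ m + 2 * delta < T^-1 * inf (cell_energies V T 0),
    0 < T & C / delta < T].
  by near=> T; split; near: T => //; apply: nbhs_pinfty_gt; exact: num_real.
move=> /filter_ex[T [infT T0 CT]].
rewrite ltr_pdivrMr// in CT.
have : inf (cell_energies V T 0) <= (m + delta) * T + C.
  apply: le_trans (CP T T0); apply: ge_inf; last exact: cell_energy_cutoff.
  by exists (T * (dot (0 : 'rV[R]_d) 0 + m)) => e; exact: cell_energy_ge.
rewrite ltr_pdivlMl// in infT; lra.
Unshelve. all: by end_near. Qed.

Lemma legendre_term_le p eta : dot p eta - f eta <= 4^-1 * dot p p - m.
Proof.
have := fhom_ge eta; suff : dot p eta <= 4^-1 * dot p p + dot eta eta by lra.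
rewrite /dot mulr_sumr -big_split/=; apply: ler_sum => i _.
by move: (p 0 i) (eta 0 i) => a b; have := sqr_ge0 (a / 2 - b); nra.
Qed.

Lemma fenchel_fhom_le p : fenchel f p <= 4^-1 * dot p p - m.
Proof.
apply: ge_sup; first by exists (dot p 0 - f 0), 0.
by move=> _ [eta _ <-]; exact: legendre_term_le.
Qed.

(** The value at [0] competes in the supremum, whatever [p] is. *)
Lemma fenchel_fhom_ge p z : V z = m -> - m <= fenchel f p.
Proof.
move=> Vz; apply: (@le_trans _ _ (- f 0)); first by rewrite lerN2 (fhom0_le Vz).
apply: ub_le_sup; last first.
  exists 0 => //; rewrite /dot big1 ?sub0r// => i _.
  by rewrite mxE mulr0.
by exists (4^-1 * dot p p - m) => _ [eta _ <-]; exact: legendre_term_le.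
Qed.

End fhom.
End cell_problem.

(** * Counting disjoint balls in a cylinder *)

Section lebesgue_balls.
Context {R : realType} {d : nat}.
Notation mu := (lebesgue_rV R d).
Implicit Types x y : 'rV[R]_d.

Lemma lebesgue_rV_ball x (r : R) : 0 < r -> mu (ball x r) = ((r *+ 2) ^+ d)%:E.
Proof.
move=> r0.
pose A (i : 'I_d) : set (measurableTypeR R) := ball (x 0 i) r.
have mA i : measurable (A i) by rewrite /A ball_itv.
have -> : ball x r = [set y | forall i, A i (y 0 i)].
  apply/seteqP; split=> [y [_ xy] i|y xy]; first exact: xy.
  by split=> // j i; rewrite ord1; exact: xy.
rewrite (lebesgue_rV_box mA) (eq_bigr (fun=> (r *+ 2)%:E)).
  by rewrite prodEFin prodr_const card_ord.
by move=> i _; rewrite /A lebesgue_measure_ball// ltW.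
Qed.

(** The norm is written in terms of a smoothed cone, whose continuity is
    known. *)
Lemma continuous_enorm : continuous (@enorm R d).
Proof.
have enormE : @enorm R d = (fun y => Num.sqrt (cone 1 0 y * cone 1 0 y - 1)).
  apply/funext => y; rewrite /enorm -expr2 sqr_cone// subr0; congr Num.sqrt.
  by rewrite expr1n addrC addKr.
have cc : continuous (cone 1 (0 : 'rV[R]_d)) by exact: continuous_cone.
rewrite enormE => x; apply: (@continuous_comp _ _ _
    (fun y : 'rV[R]_d => cone 1 0 y * cone 1 0 y - 1) Num.sqrt).
  apply: (@cvgB _ _ _ (nbhs x)); last exact: cvg_cst.
  by apply: (@cvgM _ _ (nbhs x)); exact: cc.
exact: sqrt_continuous.
Qed.

Lemma open_eball (r : R) : open (@eball R d r).
Proof.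
rewrite (_ : eball _ = (@enorm R d) @^-1` [set s | s < r])//.
by apply: open_comp; [move=> x _; exact: continuous_enorm|exact: open_lt].
Qed.

(** A cylinder is a union of translated balls. *)
Lemma open_cylinder (r : R) (xi : 'rV[R]_d) : open (cylinder r xi).
Proof.
rewrite (_ : cylinder r xi =
    \bigcup_(t in setT) ((fun x => x - t *: xi) @^-1` eball r)).
  apply: bigcup_open => t _; apply: open_comp; last exact: open_eball.
  by move=> x _; apply: (@cvgB _ _ _ (nbhs x)); [exact: cvg_id|exact: cvg_cst].
apply/seteqP; split=> [x [t [z [zr ->]]]|x [t _ xr]].
  by exists t => //; rewrite /preimage /eball /= addrC addKr.
by exists t, (x - t *: xi); split=> //; rewrite addrC subrK.
Qed.

Lemma eball_sub_ball (r : R) : 0 < r -> eball r `<=` ball (0 : 'rV[R]_d) r.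
Proof.
move=> r0 x xr; rewrite -ball_normE /= sub0r normrN.
exact: le_lt_trans (le_norm_enorm x) xr.
Qed.

(** The integral counts the disjoint balls on which the integrand is at least
    [c]. *)
Lemma Rintegral_ge_balls (W : 'rV[R]_d -> R) (M c r : R) (D : set 'rV[R]_d)
    (L : nat) (p : nat -> 'rV[R]_d) (rho : R) :
  continuous W -> (forall x, 0 <= W x) -> (forall x, W x <= M) ->
  0 < r -> open D -> D `<=` ball 0 r -> 0 < rho -> 0 <= c ->
  (forall l, (l < L)%N -> ball (p l) rho `<=` D) ->
  (forall l x, (l < L)%N -> ball (p l) rho x -> c <= W x) ->
  (forall k l, (k < L)%N -> (l < L)%N -> k != l ->
     ball (p k) rho `&` ball (p l) rho = set0) ->
  L%:R * (c * (rho *+ 2) ^+ d) <= \int[mu]_(x in D) W x.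
Proof.
move=> cW W0 WM r0 oD Dr rho0 c0 pD pc pdisj.
have mD := open_measurable_rV oD.
have mW : measurable_fun D (EFin \o W).
  apply/measurable_EFinP; apply: (@measurable_funS _ _ _ _ setT) => //.
  exact: continuous_measurable_rV.
have W0' x : D x -> (0 <= (W x)%:E)%E by rewrite lee_fin.
have M0 : 0 <= M by exact: le_trans (W0 0) (WM 0).
have fin : (\int[mu]_(x in D) (W x)%:E)%E \is a fin_num.
  rewrite ge0_fin_numE; last exact: integral_ge0.
  apply: (@le_lt_trans _ _ (\int[mu]_(x in D) (cst M%:E x))%E).
    by apply: ge0_le_integral => // x _; rewrite lee_fin.
  rewrite integral_cst// lte_mul_pinfty ?lee_fin//.
  apply: (@le_lt_trans _ _ (mu (ball 0 r))).
    by apply: le_measure => //; rewrite inE//; exact: measurable_ball_rV.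
  by rewrite lebesgue_rV_ball// ltry.
rewrite -lee_fin /Rintegral fineK//.
pose B (l : nat) := ball (p l) rho.
have mB l : measurable (B l) by exact: measurable_ball_rV.
pose s := iota 0 L.
have sE l : (l \in s) = (l < L)%N by rewrite mem_iota add0n.
pose U := \big[setU/set0]_(l <- s) B l.
have mU : measurable U by apply: bigsetU_measurable => l _.
have UD : U `<=` D.
  move=> x; rewrite /U -bigcup_seq => -[l /=]; rewrite sE => lL.
  exact: pD.
apply: (@le_trans _ _ (\int[mu]_(x in U) (W x)%:E)%E); last first.
  exact: ge0_subset_integral.
rewrite ge0_integral_bigsetU//; last 4 first.
- exact: iota_uniq.
- apply/trivIsetP => k l /=; rewrite !sE => kL lL kl.
  exact: pdisj.
- exact: measurable_funS mD UD mW.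
- by move=> x /UD; exact: W0'.
apply: (@le_trans _ _ (\sum_(l <- s) (c * (rho *+ 2) ^+ d)%:E)%E).
  rewrite sumEFin lee_fin big_const_seq count_predT size_iota iter_addr_0.
  by rewrite mulr_natl.
rewrite big_seq [leRHS]big_seq; apply: lee_sum => l; rewrite sE => lL.
have -> : (c * (rho *+ 2) ^+ d)%:E = (\int[mu]_(x in B l) (cst c%:E x))%E.
  by rewrite integral_cst//= EFinM -(lebesgue_rV_ball (p l) rho0).
apply: ge0_le_integral => //.
- exact: measurable_funS mD (pD _ lL) mW.
- by move=> x Bx; rewrite lee_fin; exact: pc Bx.
Qed.

End lebesgue_balls.

Lemma floor_row_close (R : realType) (d : nat) (x : 'rV[R]_d) :
  `|map_mx intr (\row_j Num.floor (x 0 j)) - x| <= 1.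
Proof.
rewrite [leLHS]mx_normrE; apply: bigmax_le => // -[u j] _ /=.
rewrite ord1 !mxE ler_norml; have := floor_itv (x 0 j); rewrite intrD.
by move: (Num.floor _)%:~R => w /andP[? ?]; apply/andP; split; lra.
Qed.

Section quiet_points.
Context {R : realType} {d : nat}.
Variables (W : 'rV[R]_d -> R) (M : R) (xi : 'rV[R]_d).
Hypotheses (cW : unif_continuous W) (W0 : forall x, 0 <= W x)
  (WM : forall x, W x <= M) (xi0 : xi != 0).
Hypothesis W_small : forall r : R, 0 < r ->
  rho^-1 * \int[lebesgue_rV R d]_(x in eball rho `&` cylinder r xi) W x
    @[rho --> +oo] --> (0 : R).

Lemma unif_continuous_norm (e : R) : 0 < e ->
  exists2 rho : R, 0 < rho & forall x y, `|x - y| < rho -> `|W x - W y| < e.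
Proof.
move=> e0.
have /cW : entourage [set p : R * R | `|p.1 - p.2| < e].
  by exists e => //= p; rewrite /ball /=.
rewrite /= -entourage_ballE => -[rho /= rho0 rhoP].
by exists rho => // x y xy; apply: (rhoP (x, y)); rewrite -ball_normE.
Qed.

Lemma unif_continuous_continuous : continuous W.
Proof.
move=> x; apply/(@cvgrPdist_lt _ _ _ (nbhs x)) => e e0.
have [rho rho0 rhoP] := unif_continuous_norm e0.
apply/nbhs_ballP; exists rho => // y; rewrite -ball_normE /=.
exact: rhoP.
Qed.

(** Near the point [xi / eps] of the axis, the lattice points
    [floor (xi / eps - l xi / |xi_i|)] have [i]-th coordinates decreasing or
    increasing by exactly one with [l]; hence balls of radius at most one half
    around their translates by [z] are disjoint.  The points with [l] up to a
    small multiple of [1 / eps] stay close to [xi / eps], in a cylinder of fixed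
    radius and in a ball of radius of order [1 / eps], so [W] cannot be bounded
    below on all these balls. *)
Lemma quiet_lattice_point (z : 'rV[R]_d) (delta : R) : 0 < delta ->
  \forall eps \near 0^'+, exists k : 'rV[int]_d,
    W (z + map_mx intr k) < delta /\ `|eps *: (z + map_mx intr k) - xi| <= delta.
Proof.
move=> delta0.
have [i xii] : exists i, xi 0 i != 0.
  apply/existsP; apply: contra_neqT xi0 => /existsPn xi_0.
  by apply/rowP => i; rewrite mxE; apply/eqP; have := xi_0 i; rewrite negbK.
pose a := `|xi 0 i|; have a0 : 0 < a by rewrite normr_gt0.
pose b := `|xi|; have b0 : 0 < b by rewrite normr_gt0.
have delta20 : 0 < delta / 2 by rewrite divr_gt0.
have [rho1 rho10 rho1P] := unif_continuous_norm delta20.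
pose rho := Num.min rho1 2^-1.
have rho0 : 0 < rho by rewrite lt_min rho10/= invr_gt0.
have rho_le1 : rho <= rho1 by rewrite ge_min lexx.
have rho_le2 : rho <= 2^-1 by rewrite ge_min lexx orbT.
pose kappa := delta / 2 * (rho *+ 2) ^+ d.
have kappa0 : 0 < kappa by rewrite mulr_gt0// exprn_gt0// mulrn_wgt0.
(* For l <= t / eps the displacement l |xi| / a along the axis is at most
   delta / (2 eps). *)
pose t := delta * a / (2 * b).
have t0 : 0 < t by rewrite divr_gt0 ?mulr_gt0.
pose dR : R := d%:R; have dR0 : 0 <= dR by [].
(* Z bounds the distance from the axis: |z|, the rounding, the ball. *)
pose Z := `|z| + 2; have Z0 : 0 < Z by rewrite /Z; have := normr_ge0 z; lra.
pose r := dR * Z + 1; have r0 : 0 < r by rewrite ltr_wpDl ?mulr_ge0// ltW.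
pose A := dR * (b + delta) + 1; pose B := r.
have bd0 : 0 < b + delta by rewrite addr_gt0.
have A0 : 0 < A by rewrite ltr_wpDl ?mulr_ge0// ltW.
(* The balls contribute about kappa t / eps to an integral which is less than
   c times a radius of about A / eps. *)
pose c := kappa * t / (4 * A).
have c0 : 0 < c by apply: divr_gt0; exact: mulr_gt0.
have /cvgr_lt/(_ c) small := W_small r0.
have {small} [N [_ NP]] := small c0.
near=> eps.
have eps0 : 0 < eps by near: eps; exact: nbhs_right_gt.
have epsN : eps < A / (`|N| + 1).
  by near: eps; apply: nbhs_right_lt; rewrite divr_gt0// ltr_wpDl.
have epst : eps < t / 2 by near: eps; apply: nbhs_right_lt; rewrite divr_gt0.
have epsAB : eps < A / B by near: eps; apply: nbhs_right_lt; rewrite divr_gt0.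
have epsZ : eps < delta / (2 * Z).
  by near: eps; apply: nbhs_right_lt; rewrite divr_gt0 ?mulr_gt0.
pose L := Num.trunc (t / eps).
have tL : t / eps < L%:R + 1 by rewrite natr1 truncnS_gt.
have Lt : L%:R <= t / eps by rewrite truncn_le divr_ge0 ?ltW.
pose y (l : nat) : 'rV[R]_d := (eps^-1 - l%:R / a) *: xi.
pose k (l : nat) : 'rV[int]_d := \row_j Num.floor (y l 0 j).
pose p l := z + map_mx intr (k l).
have ky l : `|map_mx intr (k l) - y l| <= 1 by exact: floor_row_close.
have ly l : (l < L)%N -> l%:R / a * b <= delta / (2 * eps).
  move=> lL; have : l%:R <= t / eps by rewrite (le_trans _ Lt)// ler_nat ltnW.
  have -> : delta / (2 * eps) = t / eps / a * b.
    by rewrite /t; field; rewrite !gt_eqF.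
  by move=> le; rewrite ler_wpM2r ?(ltW b0)// ler_wpM2r// invr_ge0 ltW.
have yn l : (l < L)%N -> `|y l| <= (b + delta) / eps.
  move=> lL; rewrite normrZ -/b.
  have le1 : `|eps^-1 - l%:R / a| <= eps^-1 + l%:R / a.
    rewrite (le_trans (ler_normB _ _))// !ger0_norm//.
      by rewrite divr_ge0// ltW.
    by rewrite invr_ge0 ltW.
  apply: (le_trans (ler_wpM2r (ltW b0) le1)); rewrite mulrDl.
  have := ly _ lL; have -> : delta / (2 * eps) = delta / eps / 2.
    by field; rewrite gt_eqF.
  have : 0 < delta / eps by rewrite divr_gt0.
  by rewrite mulrDl [eps^-1 * b]mulrC; lra.
have [//|far] := pselect (exists k : 'rV[int]_d,
    W (z + map_mx intr k) < delta /\ `|eps *: (z + map_mx intr k) - xi| <= delta).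
exfalso.
have close l : (l < L)%N -> `|eps *: p l - xi| <= delta.
  move=> lL.
  have -> : eps *: p l - xi =
      eps *: (z + (map_mx intr (k l) - y l)) - (eps * (l%:R / a)) *: xi.
    apply/rowP => j; rewrite !mxE; move: (Num.floor _)%:~R => w.
    by field; rewrite !gt_eqF.
  apply: (le_trans (ler_normB _ _)); rewrite normrZ [X in _ + X]normrZ -/b normrM.
  rewrite (gtr0_norm eps0) -mulrA -mulrDr.
  rewrite (@ger0_norm _ (l%:R / a)); last by rewrite divr_ge0// ltW.
  have nz : `|z + (map_mx intr (k l) - y l)| <= Z.
    rewrite (le_trans (ler_normD _ _))// /Z lerD2l (le_trans (ky l))//.
    by rewrite ler1n.
  apply: (@le_trans _ _ (eps * (Z + delta / (2 * eps)))).
    by rewrite ler_wpM2l ?(ltW eps0)// lerD// ly.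
  move: epsZ; rewrite ltr_pdivlMr ?mulr_gt0// => epsZ.
  have -> : eps * (Z + delta / (2 * eps)) = (eps * (2 * Z)) / 2 + delta / 2.
    by field; rewrite gt_eqF.
  by lra.
have Wp l : (l < L)%N -> delta <= W (p l).
  move=> lL; rewrite leNgt; apply/negP => Wlt; apply: far.
  by exists (k l); split=> //; exact: close.
pose rr := A / eps + B.
have rr0 : 0 < rr by rewrite addr_gt0// divr_gt0.
have count : L%:R * kappa <=
    \int[lebesgue_rV R d]_(x in eball rr `&` cylinder r xi) W x.
  have xclose l x : (l < L)%N -> ball (p l) rho x -> `|x - y l| <= Z.
    move=> lL; rewrite -ball_normE /= => px.
    have -> : x - y l = (x - p l) + (z + (map_mx intr (k l) - y l)).
      rewrite /p; move: (map_mx _ _) (y l) => u w.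
      by apply/rowP => j; rewrite !mxE; ring.
    have zk : `|z + (map_mx intr (k l) - y l)| <= `|z| + 1.
      by rewrite (le_trans (ler_normD _ _))// lerD2l ky.
    rewrite (le_trans (ler_normD _ _))// distrC (le_trans (lerD (ltW px) zk))//.
    have h12 : 2^-1 <= 1 :> R by rewrite invf_le1// ler1n.
    by rewrite addrCA /Z lerD2l lerD// (le_trans rho_le2).
  have oD : open (eball rr `&` cylinder r xi).
    by apply: openI; [exact: open_eball|exact: open_cylinder].
  have Drr : eball rr `&` cylinder r xi `<=` ball 0 rr.
    by move=> x [+ _]; exact: eball_sub_ball.
  apply: (@Rintegral_ge_balls _ _ W M (delta / 2) rr _ L p rho) => //.
  - exact: unif_continuous_continuous.
  - exact: ltW.
  - move=> l lL x px; have xy := xclose l x lL px; split.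
      rewrite /eball /=; apply: (le_lt_trans (enorm_le_norm _)).
      have : `|x| <= Z + (b + delta) / eps.
        rewrite -[x](subrK (y l)) (le_trans (ler_normD _ _))//.
        by apply: lerD => //; exact: yn.
      move=> xn; apply: (@le_lt_trans _ _ (dR * (Z + (b + delta) / eps))).
        exact: ler_wpM2l.
      have -> : rr = dR * (Z + (b + delta) / eps) + (eps^-1 + 1).
        by rewrite /rr /A /B /r; field; rewrite gt_eqF.
      by rewrite ltrDl addr_gt0// invr_gt0.
    exists (eps^-1 - l%:R / a), (x - y l); split; last by rewrite addrC subrK.
    apply: (le_lt_trans (enorm_le_norm _)); rewrite /r ltr_pwDr//.
    exact: ler_wpM2l.
  - move=> l x lL; rewrite -ball_normE /= => px.
    have := rho1P _ _ (lt_le_trans px rho_le1); have := Wp _ lL.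
    by rewrite ltr_norml => ? /andP[_ ?]; lra.
  - move=> n l nL lL nl; apply/seteqP; split=> // x [[_ /(_ 0 i) pn] [_ /(_ 0 i) pl]].
    have yE q : y q 0 i = (eps^-1 - q%:R / a) * xi 0 i by rewrite mxE.
    move: pn pl; rewrite /p !mxE /ball /= -!yE => pn pl.
    have fl q : Num.floor (y q 0 i) = Num.floor (eps^-1 * xi 0 i) - q%:Z * sgz (xi 0 i).
      rewrite yE.
      have -> : (eps^-1 - q%:R / a) * xi 0 i =
          eps^-1 * xi 0 i + (- (q%:Z * sgz (xi 0 i)))%:~R.
        rewrite mulrBl intrN intrM -sgrEz; congr (_ - _).
        rewrite {1}[xi 0 i]numEsg -/a; field.
        by rewrite gt_eqF.
      by rewrite floorDrz ?intr_int// intrKfloor.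
    pose q := Num.floor (y n 0 i) - Num.floor (y l 0 i).
    have q0 : q != 0.
      have -> : q = (l%:Z - n%:Z) * sgz (xi 0 i) by rewrite /q !fl; ring.
      by rewrite mulf_neq0 ?sgz_eq0// subr_eq0 eqz_nat eq_sym.
    have : 1 <= `|q%:~R : R| by rewrite norm_intr_ge1 ?intr_int// intr_eq0.
    rewrite leNgt => /negP; apply; rewrite /q intrB.
    have -> : (Num.floor (y n 0 i))%:~R - (Num.floor (y l 0 i))%:~R =
        (z 0 i + (Num.floor (y n 0 i))%:~R - x 0 i) -
        (z 0 i + (Num.floor (y l 0 i))%:~R - x 0 i) by ring.
    apply: (le_lt_trans (ler_normB _ _)).
    rewrite [ltRHS](_ : 1 = 2^-1 + 2^-1); last by field.
    by apply: ltrD; [exact: lt_le_trans pn rho_le2|exact: lt_le_trans pl rho_le2].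
have : rr^-1 * \int[lebesgue_rV R d]_(x in eball rr `&` cylinder r xi) W x < c.
  apply: NP; rewrite (le_lt_trans (ler_norm N))//.
  rewrite /rr ltr_wpDr ?(ltW r0)//.
  have N1 : 0 < `|N| + 1 by rewrite ltr_wpDl.
  have : `|N| + 1 < A / eps by rewrite ltr_pdivlMr// mulrC -ltr_pdivlMr.
  by apply: le_lt_trans; rewrite lerDl.
rewrite ltr_pdivrMl// => /(le_lt_trans count).
rewrite /rr /c; have -> : (A / eps + B) * (kappa * t / (4 * A)) =
    (t / eps / 4 + t * (B / A) / 4) * kappa.
  by field; rewrite !gt_eqF.
rewrite ltr_pM2r// => Lsmall.
have BA : B / A < eps^-1.
  by rewrite -[B / A]invrK ltf_pV2 ?posrE ?invr_gt0 ?divr_gt0// invf_div.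
have tBA : t * (B / A) < t / eps by rewrite ltr_pM2l.
have : t / eps < 2 by move: tL Lsmall tBA; move: (t / eps) (t * (B / A)) => u v; lra.
by rewrite ltr_pdivrMr//; lra.
Unshelve. all: by end_near. Qed.

End quiet_points.

(** * Bounds for viscosity solutions *)

Section solutions.
Context {R : realType} {d : nat}.
Implicit Types (u n : 'rV[R]_d -> R) (x y z : 'rV[R]_d).

Lemma periodic1_bounds (V : 'rV[R]_d -> R) : continuous V -> periodic1 V ->
  exists z M, forall x, V z <= V x <= M.
Proof.
move=> cV pV.
pose C := [set v : 'rV[R]_d | forall i, `[0, 1]%classic (v ord0 i)].
have cC : compact C.
  apply: (@rV_compact R d (fun=> `[0, 1]%classic)) => i.
  exact: segment_compact.
have C0 : C !=set0.
  by exists 0 => i; rewrite /= mxE in_itv/= lexx ler01.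
have cVC : {within C, continuous V} by exact: continuous_subspaceT.
have [z _ zP] := EVT_min_rV C0 cC cVC.
have [z1 _ z1P] := EVT_max_rV C0 cC cVC.
exists z, (V z1) => x.
have xC : x + map_mx intr (- (\row_j Num.floor (x 0 j))) \in C.
  rewrite inE => i; rewrite !mxE /= in_itv/= intrN.
  have := floor_itv (x 0 i); rewrite intrD ord1.
  by move: (Num.floor _)%:~R => w /andP[? ?]; apply/andP; split; lra.
by rewrite -(pV (- (\row_j Num.floor (x 0 j))) x) zP ?z1P.
Qed.

(** A continuous function exceeding its essential supremum somewhere would do
    so on a ball, which has positive measure. *)
Lemma W1oo_bounded u : continuous u -> W1oo u ->
  exists M, forall x, `|u x| <= M.
Proof.
move=> cu [+ _]; rewrite inE => /andP[_]; rewrite inE /finite_norm.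
have muT : (0 < lebesgue_rV R d [set: _])%E.
  apply: (@lt_le_trans _ _ (lebesgue_rV R d (ball 0 1))).
    by rewrite lebesgue_rV_ball// lte_fin exprn_gt0.
  by apply: le_measure; rewrite ?inE//; exact: measurable_ball_rV.
rewrite unlock muT /=; set E := ess_sup _ _ => Eoo.
have [M EM] : exists M : R, (E <= M%:E)%E.
  by move: Eoo; case: E => // [r _|_]; [exists r|exists 0; rewrite leNye].
exists M => x; rewrite leNgt; apply/negP => Mx.
have cnu : continuous (fun y => `|u y|).
  by move=> y; apply: (@cvg_norm _ _ _ (nbhs y)); exact: cu.
have /nbhs_ballP[r /= r0 rP] : \forall y \near x, M < `|u y|.
  exact: (@cvgr_gt _ _ (nbhs x) _ _ _ (cnu x) M Mx).
have [N [mN N0 PN]] := ess_sup_ge (lebesgue_rV R d) (abse \o (EFin \o u)).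
have : (lebesgue_rV R d (ball x r) <= lebesgue_rV R d N)%E.
  apply: le_measure; rewrite ?inE//; first exact: measurable_ball_rV.
  move=> y /rP My; apply: PN => /= uE.
  have : (`|u y|%:E <= M%:E)%E by exact: le_trans EM.
  by rewrite lee_fin leNgt My.
by rewrite N0 lebesgue_rV_ball// lee_fin leNgt exprn_gt0// mulrn_wgt0.
Qed.

(** A cone of slope [k] contributes at most [k ^ 2 / 4] to the equation, and [k]
    is as small as needed. *)
Lemma supersolution_ge (F : 'rV[R]_d -> R -> 'rV[R]_d -> R) u
    (M lambda m : R) : 0 < lambda -> continuous u -> (forall x, `|u x| <= M) ->
  viscosity_supersolution F u ->
  (forall z s p, F z s p <= lambda * s + (4^-1 * enorm p ^+ 2 - m)) ->
  forall x, m <= lambda * u x.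
Proof.
move=> l0 cu uM Fu FH x; apply/ler_addgt0Pr => e e0.
pose k := Num.min 1 e; have k0 : 0 < k by rewrite lt_min ltr01.
have [z0 z0P] := supersolution_cone x Fu cu uM k0 ltr01.
move=> /le_trans/(_ (FH _ _ _)).
rewrite mulNr scaleNr /enorm /dot.
under eq_bigr do rewrite mxE mulrNN.
rewrite -/(dot _ _) -/(enorm _) enorm_grad_cone// expr1n.
have := z0P x; rewrite cone_center// => ux.
have c1 := le_cone x ltr01 z0.
have uz : u z0 <= u x by have : k * 1 <= k * cone 1 x z0; [rewrite ler_pM2l|lra].
have luz : lambda * u z0 <= lambda * u x by rewrite ler_pM2l.
have k2 : k ^+ 2 <= e.
  rewrite expr2 (@le_trans _ _ (1 * k))//; last by rewrite mul1r ge_min lexx orbT.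
  by rewrite ler_pM2r// ge_min lexx.
have q0 : 0 <= 1 / cone 1 x z0 ^+ 2 by rewrite divr_ge0// sqr_ge0.
have : k ^+ 2 * (1 - 1 / cone 1 x z0 ^+ 2) <= k ^+ 2.
  by rewrite ler_piMr ?sqr_ge0// lerBlDr lerDl.
by lra.
Qed.

(** The cone forces a maximum to be attained; there the equation gives the bound,
    because the hypothesis on [F] holds for every gradient. *)
Lemma subsolution_le (F : 'rV[R]_d -> R -> 'rV[R]_d -> R) u
    (M lambda m : R) : 0 < lambda -> continuous u -> (forall x, `|u x| <= M) ->
  viscosity_subsolution F u ->
  (forall z s p, lambda * s - m <= F z s p) ->
  forall x, lambda * u x <= m.
Proof.
move=> l0 cu uM Fu FH x.
have [z0 z0P] := subsolution_cone x Fu cu uM ltr01 ltr01.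
move=> /(le_trans (FH _ _ _)).
have := z0P x; rewrite cone_center// => ux.
have c1 := le_cone x ltr01 z0.
have : lambda * u x <= lambda * u z0 by rewrite ler_pM2l//; lra.
by lra.
Qed.

(** The slope [k] is too steep for the equation far from the vertex, so the cone
    touches [u] at a distance from [y] of order [e], where the equation with its
    quadratic term dropped bounds [u] by the potential; [e] tends to zero. *)
Lemma subsolution_le_potential u n (M lambda m N k : R) : 0 < lambda ->
  continuous u -> (forall x, `|u x| <= M) -> continuous n ->
  viscosity_subsolution
    (fun x s p => lambda * s + (4^-1 * enorm p ^+ 2 - n x)) u ->
  (forall x, m <= lambda * u x) -> (forall x, n x <= N) ->
  0 < k -> 8 * (N - m) <= k ^+ 2 ->
  forall x y, lambda * u x <= n y + lambda * k * d%:R * `|x - y|.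
Proof.
move=> l0 cu uM cn Fu um nN k0 kN x y; apply/ler_addgt0Pr => eta eta0.
have /cvgrPdist_lt/(_ _ eta0)/nbhs_ballP[r /= r0 rP] := cn y.
pose e := r / 3; have e0 : 0 < e by rewrite divr_gt0.
have [z0 z0P] := subsolution_cone y Fu cu uM k0 e0.
rewrite enorm_grad_cone//.
have := cone_gt0 y e0 z0; have := le_cone y e0 z0; have := le_norm_cone y e0 z0.
have := z0P x; move: (cone e y z0) => c ux z0c ec c0 Fz.
have k20 : 0 < k ^+ 2 by rewrite exprn_gt0.
(* The gradient at the contact has squared norm at most k ^ 2 / 2. *)
have q_half : 2^-1 <= e ^+ 2 / c ^+ 2.
  rewrite -(ler_pM2l k20).
  move: Fz (um z0) (nN z0) kN; rewrite mulrBr mulr1.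
  by move: (_ * (_ / _)) => w; lra.
have c2e : c < r.
  move: q_half; rewrite ler_pdivlMr ?exprn_gt0// => q_half.
  by rewrite (_ : r = 3 * e) /e; [move: e0 q_half c0 ec; rewrite /e; nra|field].
have nz : n z0 <= n y + eta.
  have : ball y r z0 by rewrite -ball_normE /= distrC (le_lt_trans z0c).
  by move/rP => /=; rewrite ltr_norml => /andP[]; lra.
have luz : lambda * u z0 <= n z0.
  have : 0 <= k ^+ 2 * (1 - e ^+ 2 / c ^+ 2).
    rewrite mulr_ge0 ?(ltW k20)// subr_ge0 ler_pdivrMr ?exprn_gt0// mul1r.
    by rewrite ler_pXn2r// nnegrE ltW.
  by lra.
have cx := cone_le y e0 x.
have : k * (cone e y x - c) <= k * (d%:R * `|x - y|) by rewrite ler_pM2l//; lra.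
rewrite -(ler_pM2l l0) => kc.
have : lambda * u x <= lambda * (u z0 + k * (cone e y x - c)).
  by rewrite ler_pM2l//; lra.
have -> : lambda * k * d%:R * `|x - y| = lambda * (k * (d%:R * `|x - y|)) by ring.
by rewrite mulrDr; lra.
Qed.

End solutions.

(** * Convergence *)

Theorem theorem5p1 (R : realType) (d : nat) (hd : (1 < d)%N)
  (Vper : 'rV[R]_d -> R) (Vper_cont : continuous Vper)
  (Vper_per : periodic1 Vper)
  (W : 'rV[R]_d -> R) (W_ge0 : forall x, 0 <= W x)
  (W_bounded : exists M : R, forall x, W x <= M)
  (W_uc : unif_continuous W)
  (W_small : exists Xi : set 'rV[R]_d,
     [/\ Xi `<=` [set~ 0], [set~ 0] `<=` closure Xi &
       forall (xi : 'rV[R]_d) (r : R), Xi xi -> 0 < r ->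
         rho^-1 * \int[lebesgue_rV R d]_(x in eball rho `&` cylinder r xi) W x
           @[rho --> +oo] --> (0 : R)])
  (fhom : 'rV[R]_d -> R) (fhom_def : is_fhom Vper fhom)
  (lambda : R) (lambda_gt0 : 0 < lambda)
  (Ueps : R -> 'rV[R]_d -> R)
  (Ueps_W1oo : forall eps, 0 < eps -> W1oo (Ueps eps))
  (Ueps_sol : forall eps, 0 < eps ->
     viscosity_solution
       (fun x s p => lambda * s +
          (4^-1 * enorm p ^+ 2 - Vper (eps^-1 *: x) - W (eps^-1 *: x)))
       (Ueps eps))
  (U : 'rV[R]_d -> R) (U_W1oo : W1oo U)
  (U_sol : viscosity_solution (fun _ s p => lambda * s + fenchel fhom p) U) :
  forall K : set 'rV[R]_d, compact K ->
    {uniform K, Ueps eps @[eps --> 0^'+] --> U}.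
Proof.
move=> K cK.
have [z [MV zMV]] := periodic1_bounds Vper_cont Vper_per.
have Vz x : Vper z <= Vper x by have /andP[] := zMV x.
have VM x : Vper x <= MV by have /andP[] := zMV x.
have [MW WM] := W_bounded.
have [Xi [Xi0 Xi_dense Xi_small]] := W_small.
have cW : continuous W by exact: unif_continuous_continuous.
pose m := Vper z.
have UE x : lambda * U x = m.
  have [cU Usub Usup] := U_sol; have [M UM] := W1oo_bounded cU U_W1oo.
  apply/eqP; rewrite eq_le; apply/andP; split.
    apply: (subsolution_le lambda_gt0 cU UM Usub) => _ s p.
    by rewrite lerD2l (fenchel_fhom_ge Vper_cont Vz VM fhom_def p (z := z)).
  apply: (supersolution_ge lambda_gt0 cU UM Usup) => _ s p.
  rewrite lerD2l sqr_enorm.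
  exact: (fenchel_fhom_le Vper_cont Vz VM fhom_def).
have Ueps_ge eps x : 0 < eps -> m <= lambda * Ueps eps x.
  move=> eps0; have [cU _ Usup] := Ueps_sol eps eps0.
  have [M UM] := W1oo_bounded cU (Ueps_W1oo eps eps0).
  apply: (supersolution_ge lambda_gt0 cU UM Usup) => y s p.
  rewrite lerD2l; have := Vz (eps^-1 *: y); have := W_ge0 (eps^-1 *: y).
  by rewrite -/m; lra.
(* Any slope with k ^ 2 >= 8 (max - min of the potential) will do. *)
pose k := 8 * (MV + MW - m) + 1.
have MWm : 0 <= MV + MW - m.
  by have := W_ge0 0; have := WM 0; have := VM z; rewrite -/m; lra.
have k0 : 0 < k by rewrite /k; lra.
have kk : 8 * (MV + MW - m) <= k ^+ 2 by rewrite /k; nra.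
have Ueps_le eps x y : 0 < eps ->
    lambda * Ueps eps x <=
    Vper (eps^-1 *: y) + W (eps^-1 *: y) + lambda * k * d%:R * `|x - y|.
  move=> eps0; have [cU Usub _] := Ueps_sol eps eps0.
  have [M UM] := W1oo_bounded cU (Ueps_W1oo eps eps0).
  pose n (x : 'rV[R]_d) := Vper (eps^-1 *: x) + W (eps^-1 *: x).
  apply: (@subsolution_le_potential _ _ _ n M lambda m (MV + MW)) => //.
  - have cs : continuous (fun x : 'rV[R]_d => eps^-1 *: x).
      by move=> v; exact: scaler_continuous.
    have cVs : continuous (Vper \o (fun x => eps^-1 *: x)).
      by move=> v; apply: continuous_comp; [exact: cs|exact: Vper_cont].
    have cWs : continuous (W \o (fun x => eps^-1 *: x)).
      by move=> v; apply: continuous_comp; [exact: cs|exact: cW].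
    by move=> v; apply: (@cvgD _ _ _ (nbhs v)); [exact: cVs|exact: cWs].
  - rewrite (_ : (fun _ _ _ => _) = (fun x s p => lambda * s +
      (4^-1 * enorm p ^+ 2 - Vper (eps^-1 *: x) - W (eps^-1 *: x)))) //.
    by apply/funext => v; apply/funext => s; apply/funext => p; rewrite /n; ring.
  - by move=> v; exact: Ueps_ge.
  - by move=> v; rewrite /n lerD.
have unif e : 0 < e -> \forall eps \near 0^'+,
    K `<=` [set x | `|U x - Ueps eps x| < e].
  move=> e0.
  pose delta := lambda * e / (2 * (1 + 3 * (lambda * k * d%:R))).
  have lkd0 : 0 <= lambda * k * d%:R by rewrite !mulr_ge0// ltW.
  have delta0 : 0 < delta.
    by rewrite divr_gt0 ?mulr_gt0// ltr_pwDl// mulr_ge0.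
  apply: ((compact_near_coveringP K).1 cK) => x0 Kx0.
  have [xi [Xixi xi_x0]] : exists xi, Xi xi /\ `|x0 - xi| < delta.
    (* Directions are dense away from the origin only, and x0 may be 0. *)
    have [x1 x1_neq0 x01] : exists2 x1, x1 != 0 & `|x0 - x1| < delta / 2.
      have [x00|x00] := eqVneq x0 0; last first.
        by exists x0 => //; rewrite subrr normr0 divr_gt0.
      have d0 : (0 < d)%N by exact: ltnW.
      exists (const_mx (delta / 4)).
        apply/eqP => /rowP /(_ (Ordinal d0)); rewrite !mxE.
        by apply/eqP; rewrite gt_eqF// divr_gt0.
      rewrite x00 sub0r normrN (@le_lt_trans _ _ (delta / 4))//; last by lra.
      rewrite [leLHS]mx_normrE; apply: bigmax_le => [|j _]; first by lra.
      by rewrite mxE ger0_norm//; lra.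
    have /Xi_dense/(_ (ball x1 (delta / 2))) : [set~ 0] x1 by exact/eqP.
    case; first by apply: nbhsx_ballx; rewrite divr_gt0.
    move=> xi [Xixi]; rewrite -ball_normE /= => x1xi; exists xi; split=> //.
    by rewrite (le_lt_trans (ler_distD x1 _ _))//; lra.
  have xi_neq0 : xi != 0 by apply/eqP; exact: Xi0 Xixi.
  have small := quiet_lattice_point W_uc W_ge0 WM xi_neq0
    (fun r r0 => Xi_small xi r Xixi r0) z delta0.
  exists (ball x0 delta, [set eps | 0 < eps /\ exists k : 'rV[int]_d,
    W (z + map_mx intr k) < delta /\
    `|eps *: (z + map_mx intr k) - xi| <= delta]).
    split; first exact: nbhsx_ballx.
    by apply: filterI; [exact: nbhs_right_gt|exact: small].
  move=> [x eps] [/= x0x [eps0 [q [Wq qxi]]]].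
  have := Ueps_le eps x (eps *: (z + map_mx intr q)) eps0.
  rewrite !scalerA mulVf ?gt_eqF// !scale1r Vper_per -/m.
  have dist : `|x - eps *: (z + map_mx intr q)| <= 3 * delta.
    move: x0x; rewrite -ball_normE /= => x0x.
    rewrite (le_trans (ler_distD x0 _ _))// (distrC x x0).
    have := ler_distD xi x0 (eps *: (z + map_mx intr q)).
    by rewrite (distrC xi (eps *: _)); lra.
  have := ler_wpM2l lkd0 dist => lkd_dist Ule.
  have deltaE : delta + (lambda * k * d%:R) * (3 * delta) = lambda * (e / 2).
    by rewrite /delta; field; rewrite gt_eqF// ltr_pwDl// mulr_ge0.
  have Uge := Ueps_ge eps x eps0; have UEx := UE x.
  rewrite -(ltr_pM2l lambda_gt0) -[lambda in ltLHS]gtr0_norm// -normrM mulrBr.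
  have : 0 < lambda * e by rewrite mulr_gt0.
  have : lambda * (e / 2) = (lambda * e) / 2 by rewrite mulrA.
  by rewrite ltr_norml => ? ?; apply/andP; split; lra.
move=> P /uniform_nbhs[E [+ EP]].
rewrite -entourage_ballE => -[e /= e0 eE].
apply: filterS (unif e e0) => eps Keps; apply: EP => x Kx.
by apply: eE; rewrite /= -ball_normE /=; exact: Keps.
Qed.
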